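(* Let $r\geq2$ be an integer and $p>1$. If $G$ is a graph of order $n$ with $\lambda^{(p)}(G)\geq\lambda^{(p)}(T_r(n))$, then \[\mathrm{js}_{r+1}(G)>\frac{n^{r-1}}{r^{r^6p/(p-1)}},\] unless $G=T_r(n)$.
   Context: For a graph $G$ with vertex set $\{1,\dots,n\}$ and real $p\geq1$, the $p$-spectral radius is $\lambda^{(p)}(G)=\max\{2\sum_{\{i,j\}\in E(G)}x_ix_j : x_1,\dots,x_n\in\mathbb{R},\ |x_1|^p+\cdots+|x_n|^p=1\}$. $T_r(n)$ is the complete $r$-partite graph of order $n$ whose parts have sizes $\lfloor n/r\rfloor$ or $\lceil n/r\rceil$. An $s$-joint of size $t$ is a collection of $t$ distinct $s$-cliques (complete subgraphs on $s$ vertices) all sharing a common edge; $\mathrm{js}_s(G)$ is the maximum size of an $s$-joint in $G$. *)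

(* Defs.v *)
From mathcomp Require Import all_boot all_order all_fingroup all_algebra.
From mathcomp Require Import all_classical all_reals all_analysis.
From mathcomp Require Import zify.

Set Implicit Arguments.
Unset Strict Implicit.
Unset Printing Implicit Defensive.

Import Order.TTheory GRing.Theory Num.Theory.
Import numFieldNormedType.Exports.

Local Open Scope classical_set_scope.
Local Open Scope ring_scope.

Record sgraph (n : nat) := SGraph {
  adj :> rel 'I_n;
  adj_sym : symmetric adj;
  adj_irr : irreflexive adj
}.

Definition graph_iso (n : nat) (G H : sgraph n) : Prop :=
  exists s : 'S_n, forall i j : 'I_n, G i j = H (s i) (s j).

Definition lagr (R : realType) (n : nat) (G : sgraph n) (x : 'rV[R]_n) : R :=
  2 * \sum_(i < n) \sum_(j < n | (i < j)%N && G i j) x 0 i * x 0 j.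

Definition psphere (R : realType) (p : R) (n : nat) : set 'rV[R]_n :=
  [set x | \sum_(i < n) `|x 0 i| `^ p = 1].

Arguments psphere {R} p n.

(* The supremum is a maximum as soon as 0 < n and 0 < p: see
   [pspectral_radius_max] below. For n = 0 the sphere is empty and the value
   is 0. *)
Definition pspectral_radius (R : realType) (p : R) (n : nat) (G : sgraph n) : R :=
  sup (lagr G @` psphere p n).

Lemma turan_sym (r n : nat) : symmetric (fun i j : 'I_n => (i %% r != j %% r)%N).
Proof. by move=> i j; rewrite eq_sym. Qed.

Lemma turan_irr (r n : nat) : irreflexive (fun i j : 'I_n => (i %% r != j %% r)%N).
Proof. by move=> i; rewrite eqxx. Qed.

(* The parts are the residue classes modulo r; their sizes are computed in
   [turan_part_size]. When n < r, the remaining r - n parts are empty. *)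
Definition turan (r n : nat) : sgraph n :=
  SGraph (@turan_sym r n) (@turan_irr r n).

Definition is_clique (n : nat) (G : sgraph n) (s : nat) (K : {set 'I_n}) : bool :=
  (#|K| == s) && [forall i in K, forall j in K, (i != j) ==> G i j].

Definition is_joint (n : nat) (G : sgraph n) (s : nat)
    (C : {set {set 'I_n}}) : bool :=
  [forall K in C, is_clique G s K] &&
  [exists i, exists j, G i j && [forall K in C, (i \in K) && (j \in K)]].

(* Equal to 0 when G has no edge. *)
Definition js (n : nat) (G : sgraph n) (s : nat) : nat :=
  \max_(C : {set {set 'I_n}} | is_joint G s C) #|C|.

Lemma turan_part_size (r n k : nat) : (k < r)%N ->
  #|[pred i : 'I_n | (i %% r == k)%N]| = (n %/ r + (k < n %% r))%N.
Proof.
move=> kr; have r0 : (0 < r)%N by exact: leq_ltn_trans kr.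
elim: n => [|n IHn].
  by rewrite div0n mod0n eq_card0// => -[].
have -> : #|[pred i : 'I_n.+1 | (i %% r == k)%N]| =
    (#|[pred i : 'I_n | (i %% r == k)%N]| + (n %% r == k))%N.
  rewrite -!sum1_card big_mkcond [in RHS]big_mkcond big_ord_recr/=.
  by rewrite !inE/=; congr (_ + _)%N; case: ifP.
have := ltn_pmod n r0; rewrite IHn [in RHS](divn_eq n r) -addnS.
rewrite divnMDl// modnMDl; move: (n %% r)%N => m mr; rewrite -!addnA.
congr (_ + _)%N; have [mr1|rm] := ltnP m.+1 r.
  rewrite divn_small// modn_small// add0n.
  lia.
have -> : m.+1 = r by apply/eqP; rewrite eqn_leq mr.
rewrite divnn modnn r0 ltn0 addn0.
lia.
Qed.

Lemma continuous_norm_powR (R : realType) (p : R) : 0 < p ->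
  continuous (fun t : R => `|t| `^ p).
Proof.
move=> p0 t; have [->|t0] := eqVneq t 0.
- apply/cvgrPdist_lt => e e0; rewrite normr0 powR0 ?gt_eqF//.
  near=> u; rewrite sub0r normrN ger0_norm ?powR_ge0//.
  rewrite -(powRr1 (ltW e0)) -(@mulVf _ p) ?gt_eqF// powRrM.
  rewrite gt0_ltr_powR// ?nnegrE ?powR_ge0//.
  near: u; exists (e `^ p^-1) => /=; first exact: powR_gt0.
  by move=> v /=; rewrite sub0r normrN.
- have nt0 : 0 < `|t| by rewrite normr_gt0.
  apply: (@continuous_comp R R R (fun u : R => `|u|) (fun u => u `^ p) t).
    exact: norm_continuous.
  apply/differentiable_continuous/derivable1_diffP.
  by apply: derivable_powR; rewrite in_itv/= nt0.
Unshelve. all: by end_near. Qed.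

Lemma continuous_lagr (R : realType) (n : nat) (G : sgraph n) :
  continuous (@lagr R n G).
Proof.
have cs : continuous (fun x : 'rV[R]_n =>
    \sum_(i < n) \sum_(j < n | (i < j)%N && G i j) x 0 i * x 0 j).
  apply: continuous_big => [|i _]; first exact: add_continuous.
  apply: continuous_big => [|j _ x]; first exact: add_continuous.
  by apply: continuousM; apply: coord_continuous.
move=> x; apply: (@continuousM R 'rV[R]_n (fun=> 2)); last exact: cs.
exact: cst_continuous.
Qed.

Lemma psphere_neq0 (R : realType) (p : R) (n : nat) :
  0 < p -> (0 < n)%N -> (psphere p n) !=set0.
Proof.
case: n => // n p0 _; exists (delta_mx 0 0) => /=.
rewrite /psphere/= (bigD1 ord0)//= big1 ?addr0 => [|i i0]; rewrite mxE eqxx/=.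
  by rewrite normr1 powR1.
by rewrite (negbTE i0) normr0 powR0// gt_eqF.
Qed.

Lemma psphere_compact (R : realType) (p : R) (n : nat) :
  0 < p -> compact (psphere p n).
Proof.
move=> p0; apply: bounded_closed_compact.
  exists 1; split; first exact: real1.
  move=> M M1 x /= x1; rewrite [leLHS]/Num.norm/= mx_normrE.
  apply/bigmax_leP; split=> [|[i j] _ /=]; first exact: le_trans (ltW M1).
  rewrite ord1; apply: le_trans (ltW M1).
  rewrite leNgt; apply/negP => xj.
  suff : 1 < \sum_(i < n) `|x 0 i| `^ p by rewrite [ltRHS]x1 ltxx.
  rewrite (bigD1 j)//= ltr_wpDr//.
    by apply: sumr_ge0 => k _; exact: powR_ge0.
  by rewrite -[ltLHS](congr1 (@^~ p) (powR1 R)) gt0_ltr_powR// nnegrE.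
rewrite (_ : psphere p n =
    (fun x : 'rV[R]_n => \sum_(i < n) `|x 0 i| `^ p) @^-1` [set 1])//.
apply: preimage_closed; last exact: closed_eq.
move=> x _; move: x.
apply: continuous_big => [|i _ x]; first exact: add_continuous.
apply: (@continuous_comp 'rV[R]_n R R (fun x : 'rV[R]_n => x 0 i)
                                (fun t => `|t| `^ p)).
  exact: coord_continuous.
exact: continuous_norm_powR.
Qed.

Lemma pspectral_radius_max (R : realType) (p : R) (n : nat) (G : sgraph n) :
  0 < p -> (0 < n)%N ->
  exists x : 'rV[R]_n, [/\ psphere p n x, pspectral_radius p G = lagr G x &
    forall y, psphere p n y -> lagr G y <= lagr G x].
Proof.
move=> p0 n0.
have [x /set_mem xS xmax] := @EVT_max_rV R n (lagr G) (psphere p n)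
  (psphere_neq0 p0 n0) (psphere_compact (n:=n) p0)
  (continuous_subspaceT (@continuous_lagr R n G)).
have xub : ubound (lagr G @` psphere p n) (lagr G x).
  by move=> _ [y yS <-]; apply: xmax; exact: mem_set.
exists x; split => // [|y yS]; last by apply: xmax; exact: mem_set.
apply/eqP; rewrite eq_le; apply/andP; split.
  by apply: ge_sup => //; exists (lagr G x), x.
by apply: ub_le_sup; [exists (lagr G x)|exists x].
Qed.

(* Main.v *)
(** Write q = 2 - 2/p, and phi(H) = lambda(H) / m^q for a graph H of order m.

    If G has no K_{r+1}, Erdos's degree majorization, weighted by an extremal
    vector of G, yields an r-partite graph with a spectral radius at least as
    large, and among complete r-partite graphs the balanced one is the unique
    maximizer; hence G = T_r(n). This settles small n, where the bound is
    below 1.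

    For large n suppose that every edge lies in few copies of K_{r+1}. A graph
    containing K_{r+1} with minimum degree above (1 - 1/r - 1/r^5) m has an
    edge in many copies of K_{r+1}, so some vertex has low degree. By Hoelder's
    inequality the smallest entry of the extremal vector x is then so small
    that deleting its vertex multiplies phi by 1 + c/m. Since phi(T_r(n)) is
    nearly 1 - 1/r, already the first deletion gives phi > 1 - 1/r, so K_{r+1}
    persists, and after n/2 deletions phi > 1 - 1/r + theta. Hoelder's
    inequality turns this into edge density above 1 - 1/r + theta for either
    the uniform weights 1/m or the weights x_i^p, both of which are O(1/m);
    the Moon-Moser inequalities then give about m^(r+1) copies of K_{r+1}, and
    some edge lies in too many of them. *)
Require Import Defs.
From mathcomp Require Import all_boot all_order all_fingroup all_algebra.
From mathcomp Require Import all_classical all_reals all_analysis.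
From mathcomp Require Import zify ring lra finset.

Import Order.TTheory GRing.Theory Num.Theory.
Import numFieldNormedType.Exports.
Local Open Scope ring_scope.

Set Implicit Arguments.
Unset Strict Implicit.
Unset Printing Implicit Defensive.

(** * Weighted clique counts *)

Definition common_nbr (n : nat) (G : sgraph n) (K : {set 'I_n}) : {set 'I_n} :=
  [set w | [forall v in K, G v w]].

Lemma common_nbrP n (G : sgraph n) (K : {set 'I_n}) w :
  reflect (forall v, v \in K -> G v w) (w \in common_nbr G K).
Proof. by rewrite inE; exact: forall_inP. Qed.

Lemma common_nbr_notin n (G : sgraph n) (K : {set 'I_n}) w :
  w \in common_nbr G K -> w \notin K.
Proof.
by move=> /common_nbrP wK; apply/negP => /wK; rewrite adj_irr.
Qed.

Lemma is_cliqueP n (G : sgraph n) s (K : {set 'I_n}) :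
  reflect (#|K| = s /\ {in K &, forall i j, i != j -> G i j}) (is_clique G s K).
Proof.
apply: (iffP andP) => -[Ks cK]; split; [exact/eqP| |exact/eqP|].
  by move=> i j iK jK; move/forall_inP/(_ i iK)/forall_inP/(_ j jK)/implyP : cK.
by apply/forall_inP => i iK; apply/forall_inP => j jK; apply/implyP; exact: cK.
Qed.

Lemma is_clique_setU1 n (G : sgraph n) s (M : {set 'I_n}) w : w \notin M ->
  is_clique G s.+1 (w |: M) = is_clique G s M && (w \in common_nbr G M).
Proof.
move=> wM; apply/is_cliqueP/andP.
  rewrite cardsU1 wM => -[[Ms] cl]; split; last first.
    apply/common_nbrP => v vM; apply: cl; rewrite ?inE ?eqxx ?vM ?orbT//.
    by apply: contraNneq wM => <-.
  apply/is_cliqueP; split=> // i j iM jM; apply: cl; rewrite inE ?iM ?jM orbT//.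
move=> [/is_cliqueP[Ms cl] /common_nbrP wn]; rewrite cardsU1 wM Ms; split=> //.
move=> i j; rewrite !inE => /predU1P[->|iM] /predU1P[->|jM]; rewrite ?eqxx//.
- by move=> _; rewrite adj_sym; exact: wn.
- by move=> _; exact: wn.
- exact: cl.
Qed.

(** A clique with a marked vertex is the same thing as a smaller clique with a common neighbour
    adjoined. This bijection drives [clique_weight_succ], [moon_moser] and [js_ge_greedy]. *)
Lemma sum_clique_face (V : nmodType) n (G : sgraph n) s
    (F : {set 'I_n} -> 'I_n -> V) :
  \sum_(K | is_clique G s.+1 K) \sum_(w in K) F (K :\ w) w =
  \sum_(M | is_clique G s M) \sum_(w in common_nbr G M) F M w.
Proof.
rewrite !pair_big_dep/= (reindex_onto
  (fun q : {set 'I_n} * 'I_n => (q.2 |: q.1, q.2))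
  (fun q : {set 'I_n} * 'I_n => (q.1 :\ q.2, q.2))); last first.
  by move=> [K w] /= /andP[_ wK]; rewrite setD1K.
apply: eq_big => /= [[M w] /=|[M w] /= /andP[_ /eqP[-> //]]].
rewrite setU11 andbT xpair_eqE eqxx andbT.
have [wM|wM] := boolP (w \in M).
  have /negPf-> : (w |: M) :\ w != M.
    by apply: contraTneq wM => <-; rewrite !inE eqxx.
  by rewrite andbF; apply/esym/negP => /andP[_ /common_nbr_notin]; rewrite wM.
by rewrite setU1K// eqxx andbT is_clique_setU1.
Qed.

(** For weights of total 1 this is a clique density with respect to a possibly non-uniform
    distribution; it is applied to the weights 1/n and to x_i^p. *)
Definition clique_weight (R : realFieldType) n (G : sgraph n) (y : 'I_n -> R) s :=
  \sum_(K | is_clique G s K) \prod_(i in K) y i.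

Definition weight (R : realFieldType) n (y : 'I_n -> R) (A : {set 'I_n}) :=
  \sum_(i in A) y i.

Lemma clique_weight_ge0 (R : realFieldType) n (G : sgraph n) (y : 'I_n -> R) s :
  (forall i, 0 <= y i) -> 0 <= clique_weight G y s.
Proof. by move=> y0; apply: sumr_ge0 => K _; apply: prodr_ge0. Qed.

(** Each clique on s + 1 vertices arises once from each of its s + 1 facets. *)
Lemma clique_weight_succ (R : realFieldType) n (G : sgraph n) (y : 'I_n -> R) s :
  \sum_(M | is_clique G s M) (\prod_(i in M) y i) * weight y (common_nbr G M) =
  s.+1%:R * clique_weight G y s.+1.
Proof.
under eq_bigr do rewrite /weight big_distrr/=.
rewrite -(sum_clique_face _ _ (fun M w => (\prod_(i in M) y i) * y w)).
rewrite /clique_weight big_distrr/=; apply: eq_bigr => K /is_cliqueP[Ks _].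
rewrite (eq_bigr (fun _ => \prod_(i in K) y i)) => [|w wK]; last first.
  by rewrite mulrC [RHS](big_setD1 w wK).
by rewrite sumr_const Ks mulr_natl.
Qed.

Lemma clique_weight1 (R : realFieldType) n (G : sgraph n) (y : 'I_n -> R) :
  clique_weight G y 1 = weight y [set: 'I_n].
Proof.
have := clique_weight_succ G y 0; rewrite mul1r => <-.
rewrite (big_pred1 set0) => [|M].
  rewrite big_set0 mul1r; congr weight; apply/setP => i.
  by rewrite !inE; apply/forall_inP => v; rewrite inE.
apply/is_cliqueP/eqP => [[/eqP]|->]; first by rewrite cards_eq0 => /eqP.
by rewrite cards0; split=> // i j; rewrite inE.
Qed.

(* A vertex outside the common neighbourhood of [K] extends at most one
   facet of [K]. *)
Lemma sum_weight_facets (R : realFieldType) n (G : sgraph n) (y : 'I_n -> R)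
    (K : {set 'I_n}) : (forall i, 0 <= y i) -> (0 < #|K|)%N ->
  \sum_(v in K) weight y (common_nbr G (K :\ v)) <=
  weight y setT + (#|K|%:R - 1) * weight y (common_nbr G K).
Proof.
move=> y0 K0; rewrite /weight.
under eq_bigr do rewrite big_mkcond/=.
rewrite exchange_big/= [X in _ + _ * X]big_mkcond/= big_distrr/=.
rewrite [X in _ <= X + _]big_mkcond -big_split/=; apply: ler_sum => w _.
rewrite -big_mkcondr/= sumr_const inE.
rewrite -[y w *+ _]mulr_natl -[X in _ <= X + _]mul1r.
have [wK|wK] := boolP (w \in common_nbr G K).
  rewrite -mulrDl addrC subrK ler_wpM2r ?ler_nat ?subset_leq_card//.
  by apply/fintype.subsetP => v; rewrite unfold_in => /andP[].
rewrite mulr0 addr0 ler_wpM2r// (ler_nat _ _ 1).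
apply/card_le1P => v; rewrite unfold_in => /andP[vK /common_nbrP wv] v'.
rewrite unfold_in [RHS]inE; apply/andP/eqP => [[v'K /common_nbrP wv']|->//]; last first.
  by split=> //; apply/common_nbrP.
apply: contraNeq wK => vv'; apply/common_nbrP => z zK.
have [zv|zv] := eqVneq z v; last by apply: wv; rewrite !inE zv.
by apply: wv'; rewrite !inE zK zv eq_sym vv'.
Qed.

(** The nonnegative double sum of P_i P_j (d_i - d_j)^2 expands to 2 (A C - B^2); no root or
    division enters. *)
Lemma cauchy_schwarz_sum (R : realFieldType) (I : finType) (Q : pred I)
    (P d : I -> R) : (forall i, 0 <= P i) ->
  (\sum_(i | Q i) P i * d i) ^+ 2 <=
  (\sum_(i | Q i) P i) * \sum_(i | Q i) P i * d i ^+ 2.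
Proof.
move=> P0; set A := \sum_(i | Q i) P i; set B := \sum_(i | Q i) P i * d i.
set C := \sum_(i | Q i) P i * d i ^+ 2.
have : 0 <= \sum_(i | Q i) \sum_(j | Q j) P i * P j * (d i - d j) ^+ 2.
  by do 2!apply: sumr_ge0 => ? _; rewrite mulr_ge0 ?sqr_ge0// mulr_ge0.
rewrite (eq_bigr (fun i => P i * d i ^+ 2 * A - 2 * (P i * d i) * B + P i * C)).
  rewrite big_split/= sumrB -!mulr_suml -mulr_sumr -/A -/B -/C; lra.
move=> i _; rewrite /A /B /C !mulr_sumr -sumrB -big_split/=.
by apply: eq_bigr => j _; ring.
Qed.

(** Cauchy-Schwarz over the s-cliques M, with mass [P M] and value [d M]: the first moment counts
    (s+1)-cliques, and the second, regrouped over (s+1)-cliques, is controlled by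
    [sum_weight_facets]. *)
Lemma moon_moser (R : realFieldType) n (G : sgraph n) (y : 'I_n -> R) s :
  (forall i, 0 <= y i) -> weight y setT = 1 ->
  s.+1%:R ^+ 2 * clique_weight G y s.+1 ^+ 2 <= clique_weight G y s *
    (clique_weight G y s.+1 + s%:R * s.+2%:R * clique_weight G y s.+2).
Proof.
move=> y0 y1; set k := clique_weight G y.
pose P (M : {set 'I_n}) := \prod_(i in M) y i.
pose d (M : {set 'I_n}) := weight y (common_nbr G M).
have P0 M : 0 <= P M by exact: prodr_ge0.
have sq : \sum_(M | is_clique G s M) P M * d M ^+ 2 <=
    k s.+1 + s%:R * s.+2%:R * k s.+2.
  have -> : \sum_(M | is_clique G s M) P M * d M ^+ 2 =
      \sum_(K | is_clique G s.+1 K) P K * \sum_(w in K) d (K :\ w).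
    rewrite (eq_bigr (fun M => \sum_(w in common_nbr G M) (P M * d M) * y w));
      last by move=> M _; rewrite -big_distrr/= expr2 mulrA.
    rewrite -(sum_clique_face _ _ (fun M w => P M * d M * y w)).
    apply: eq_bigr => K _; rewrite big_distrr/=; apply: eq_bigr => w wK.
    by rewrite /P (big_setD1 w wK)/= mulrC mulrA.
  rewrite -mulrA -clique_weight_succ [k _]/clique_weight big_distrr/= -big_split/=.
  apply: ler_sum => K /is_cliqueP[Ks _]; rewrite -/(P K) -/(d K).
  have := @sum_weight_facets R n G y K y0; rewrite Ks y1 => /(_ isT) le.
  apply: le_trans (ler_wpM2l (P0 K) le) _.
  by rewrite -natr1 addrK -/(d K) mulrDr mulr1 mulrCA.
apply: le_trans (ler_wpM2l (clique_weight_ge0 _ _ y0) sq).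
have := @cauchy_schwarz_sum R _ (is_clique G s) P d P0.
by rewrite clique_weight_succ exprMn.
Qed.

(* The case [s = r] supplies copies of K_{r+1}; the slack [th] is what
   makes it positive. *)
Lemma clique_weight_ratio (R : realFieldType) n (G : sgraph n) (y : 'I_n -> R)
    (r : nat) (th : R) (s : nat) :
  (forall i, 0 <= y i) -> weight y setT = 1 -> 0 < th -> (0 < r)%N ->
  1 - r%:R^-1 + th <= 2 * clique_weight G y 2 ->
  (s < r)%N -> 0 < clique_weight G y s.+1 /\
  (1 - s.+1%:R / r%:R + s.+1%:R * th) * clique_weight G y s.+1 <=
  s.+2%:R * clique_weight G y s.+2.
Proof.
move=> y0 y1 th0 r0 k2; set k := clique_weight G y.
have k1 : k 1 = 1 by rewrite /k clique_weight1.
have r0' : 0 < r%:R :> R by rewrite ltr0n.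
elim: s => [_|s IH sr].
  by rewrite k1 ltr01 mulr1 mul1r mul1r.
have [k0 le] := IH (ltnW sr).
set A := 1 - _ + _ in le.
have A0 : 0 < A.
  rewrite /A ltr_wpDr ?mulr_ge0 ?ltW// subr_gt0 ltr_pdivrMr// mul1r ltr_nat//.
have k0' : 0 < k s.+2.
  have : 0 < A * k s.+1 by rewrite mulr_gt0.
  by move=> /lt_le_trans/(_ le); rewrite pmulr_rgt0.
split=> //; have := @moon_moser R n G y s.+1 y0 y1; rewrite -!/(k _) => mm.
rewrite -(ler_pM2l k0) -(ler_pM2l (ltr0Sn R s)).
have := ler_wpM2l (ltW k0') le.
have sE : s.+2%:R = s.+1%:R + 1 :> R by rewrite natr1.
(* The coefficients A and A' of consecutive steps satisfy (s + 2) A = (s + 1) A' + 1, which matches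
   Moon-Moser at s + 1. *)
have -> : s.+1%:R * (k s.+1 * ((1 - s.+2%:R / r%:R + s.+2%:R * th) * k s.+2)) =
   s.+2%:R * (k s.+2 * (A * k s.+1)) - k s.+1 * k s.+2.
  by rewrite /A sE; ring.
move=> /(ler_wpM2l (ler0n R s.+2)); move: mm; lra.
Qed.

(** * Joints *)

Lemma js_ge n (G : sgraph n) s i j : G i j ->
  (#|[set K | is_clique G s K && ((i \in K) && (j \in K))]| <= js G s)%N.
Proof.
move=> Gij; apply: (leq_bigmax_cond (F := fun C : {set {set 'I_n}} => #|C|)).
apply/andP; split.
  by apply/forall_inP => K; rewrite inE => /andP[].
apply/existsP; exists i; apply/existsP; exists j; rewrite Gij/=.
by apply/forall_inP => K; rewrite inE => /andP[].
Qed.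

Lemma is_clique_edge n (G : sgraph n) s K : is_clique G s K -> (2 <= s)%N ->
  exists i j, [/\ i \in K, j \in K & G i j].
Proof.
move=> /is_cliqueP[<- cK] /card_gt1P[i [j [iK jK ij]]].
by exists i, j; split=> //; exact: cK.
Qed.

Lemma js_gt0 n (G : sgraph n) s K : is_clique G s K -> (2 <= s)%N ->
  (0 < js G s)%N.
Proof.
move=> cK s2; have [i [j [iK jK Gij]]] := is_clique_edge cK s2.
apply: leq_trans (js_ge s Gij); apply/card_gt0P; exists K.
by rewrite inE cK iK jK.
Qed.

Lemma js_induced m n (H : sgraph m) (G : sgraph n) (f : 'I_m -> 'I_n) s :
  injective f -> (forall i j, H i j = G (f i) (f j)) -> (js H s <= js G s)%N.
Proof.
move=> f_inj HG; apply/bigmax_leqP => C /andP[/forall_inP cC].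
move=> /existsP[i /existsP[j /andP[Hij /forall_inP ijC]]].
rewrite -(card_imset (mem C) (imset_inj f_inj)).
apply: leq_trans (js_ge s (etrans (esym (HG i j)) Hij)).
apply: subset_leq_card; apply/fintype.subsetP => _ /imsetP[K KC ->].
have /andP[iK jK] := ijC _ KC; rewrite inE !imset_f// !andbT.
have /is_cliqueP[Ks cK] := cC _ KC.
apply/is_cliqueP; split; first by rewrite card_imset.
move=> _ _ /imsetP[a aK ->] /imsetP[b bK ->] ab.
by rewrite -HG; apply: cK => //; apply: contraNneq ab => ->.
Qed.

(** A clique on at least two vertices contains an edge, and at most [js G s] cliques pass through
    each of the at most n^2 ordered edges. *)
Lemma card_cliques_js n (G : sgraph n) s : (2 <= s)%N ->
  (#|[set K | is_clique G s K]| <= n * n * js G s)%N.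
Proof.
move=> s2; pose E := [set e : 'I_n * 'I_n | G e.1 e.2].
apply: (@leq_trans (\sum_(e in E) js G s)%N); last first.
  rewrite sum_nat_const leq_mul2r; apply/orP; right.
  by apply: leq_trans (max_card _) _; rewrite card_prod card_ord.
apply: (@leq_trans (\sum_(e in E)
   #|[set K | is_clique G s K && ((e.1 \in K) && (e.2 \in K))]|)%N); last first.
  by apply: leq_sum => e; rewrite inE; exact: js_ge.
rewrite -sum1_card.
under [X in (_ <= X)%N]eq_bigr do rewrite -sum1_card big_mkcond/=.
rewrite exchange_big/= big_mkcond/=; apply: leq_sum => K _; rewrite inE.
case: ifP => // cK; have [i [j [iK jK Gij]]] := is_clique_edge cK s2.
by rewrite (bigD1 (i, j))/= ?inE// cK iK jK.
Qed.

Lemma clique_weight_le_js (R : realFieldType) n (G : sgraph n)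
    (y : 'I_n -> R) (B : R) s : (2 <= s)%N -> (forall i, 0 <= y i <= B) ->
  clique_weight G y s <= B ^+ s * (n%:R ^+ 2 * (js G s)%:R).
Proof.
move=> s2 yB.
apply: (@le_trans _ _ (\sum_(K | is_clique G s K) B ^+ s)).
  apply: ler_sum => K /is_cliqueP[<- _]; rewrite -prodr_const.
  by apply: ler_prod => i _; exact: yB.
rewrite (eq_bigl (fun K => K \in [set K | is_clique G s K])) => [|K]; last by rewrite inE.
rewrite sumr_const -[_ *+ #|_|]mulr_natr.
(* Without vertices nothing forces [B] to be nonnegative, but then both sides vanish. *)
have [n0|n0] := posnP n; last first.
  rewrite ler_wpM2l//.
    have /andP[y0 yB0] := yB (Ordinal n0); rewrite exprn_ge0//; exact: le_trans yB0.
  by rewrite expr2 -!natrM ler_nat card_cliques_js.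
rewrite (_ : #|_| = 0%N); first by rewrite (_ : n%:R = 0 :> R) ?n0// expr0n mul0r !mulr0.
apply/eqP; rewrite -leqn0 (leq_trans (card_cliques_js G s2))//.
by rewrite leqn0 !muln_eq0; apply/orP; left; rewrite n0.
Qed.

Lemma card_bigcup_le (T I : finType) (A : pred I) (F : I -> {set T}) :
  (#|\bigcup_(i | A i) F i| <= \sum_(i | A i) #|F i|)%N.
Proof.
elim/big_rec2: _ => [|i u S _ IH]; first by rewrite cards0.
by rewrite (leq_trans (leq_card_setU _ _))// leq_add2l.
Qed.

(** A common neighbour lost on enlarging [A] to [M] is a non-neighbour of some added vertex. *)
Lemma common_nbr_setU n (G : sgraph n) (A M : {set 'I_n}) : A \subset M ->
  (#|common_nbr G A| <=
   #|common_nbr G M| + \sum_(v in M :\: A) #|[set w | ~~ G v w]|)%N.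
Proof.
move=> AM; apply: leq_trans (leq_add (leqnn _) (card_bigcup_le _ _)).
apply: leq_trans (leq_card_setU _ _); apply: subset_leq_card.
apply/fintype.subsetP => w /common_nbrP wA; rewrite inE.
have [//|wM/=] := boolP (w \in common_nbr G M).
have [v vM Gvw] : exists2 v, v \in M & ~~ G v w.
  by apply/exists_inP; move: wM; rewrite inE negb_forall_in.
apply/bigcupP; exists v; rewrite !inE ?vM ?andbT//.
by apply: contra Gvw; exact: wA.
Qed.

(** Cliques through the edge ij are grown one vertex at a time. Each vertex beyond i and j spoils at
    most [b] candidates, so at least [a] extensions remain at each of the s + 1 steps, and each
    enlarged clique is reached from at most s + 3 smaller ones. *)
Lemma js_ge_greedy (R : realFieldType) n (G : sgraph n) i j s (a b : R) :
  G i j -> 0 <= a -> 0 <= b ->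
  (forall v, #|[set w | ~~ G v w]|%:R <= b) ->
  a + s%:R * b <= #|common_nbr G [set i; j]|%:R ->
  (a / s.+3%:R) ^+ s.+1 <= (js G s.+3)%:R.
Proof.
move=> Gij a0 b0 degb codeg.
pose c t := #|[set K | is_clique G t K && ((i \in K) && (j \in K))]|.
have ij : i != j by apply: contraTneq Gij => ->; rewrite adj_irr.
suff H t : (t <= s.+1)%N -> (a / s.+3%:R) ^+ t <= (c t.+2)%:R :> R.
  by apply: le_trans (H _ (leqnn _)) _; rewrite ler_nat js_ge.
elim: t => [_|t IH ts].
  rewrite expr0 (ler_nat _ 1) card_gt0; apply/set0Pn; exists [set i; j].
  rewrite !inE !eqxx orbT !andbT; apply/is_cliqueP; split; first by rewrite cards2 ij.
  move=> x y; rewrite !inE => /orP[]/eqP-> /orP[]/eqP->; rewrite ?eqxx//.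
  by rewrite adj_sym.
have {}IH := IH (ltnW ts); rewrite exprS.
have cE t' : (c t')%:R = \sum_(K | is_clique G t' K)
    (if (i \in K) && (j \in K) then 1 else 0) :> R.
  by rewrite -big_mkcondr/= sumr_const; congr (_%:R); apply: eq_card => K; rewrite !inE.
have cnb M : is_clique G t.+2 M -> (i \in M) && (j \in M) ->
    a <= #|common_nbr G M|%:R.
  move=> /is_cliqueP[Mt _] /andP[iM jM].
  have ijM : [set i; j] \subset M.
    by apply/fintype.subsetP => x; rewrite !inE => /orP[]/eqP->.
  rewrite -(lerD2r (s%:R * b)); apply: le_trans codeg _.
  apply: (le_trans (y := #|common_nbr G M|%:R + t%:R * b)); last first.
    by rewrite lerD2l ler_wpM2r// ler_nat.
  apply: (le_trans (y := (#|common_nbr G M| +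
     \sum_(v in M :\: [set i; j]) #|[set w | ~~ G v w]|)%:R)).
    by rewrite ler_nat common_nbr_setU.
  rewrite natrD lerD2l natr_sum.
  apply: (le_trans (y := \sum_(v in M :\: [set i; j]) b)); first exact: ler_sum.
  rewrite sumr_const cardsD (finset.setIidPr ijM) Mt cards2 ij subSS subSS subn0.
  by rewrite mulr_natl.
have step : a * (c t.+2)%:R <= t.+3%:R * (c t.+3)%:R.
  have -> : a * (c t.+2)%:R = \sum_(M | is_clique G t.+2 M)
      (if (i \in M) && (j \in M) then a else 0).
    rewrite cE big_distrr/=; apply: eq_bigr => M _.
    by case: ifP; rewrite ?mulr1 ?mulr0.
  apply: (le_trans (y := \sum_(M | is_clique G t.+2 M) \sum_(w in common_nbr G M)
      (if (i \in M) && (j \in M) then 1 else 0))).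
    apply: ler_sum => M Mc; rewrite sumr_const.
    by case: ifP => ijM; [exact: cnb|rewrite mul0rn].
  (* The pair (M, w) becomes the clique K on M and w with w marked; K contains i and j as soon as M
     does, and leaves t + 3 choices for w. *)
  rewrite -(sum_clique_face _ _ (fun M w => if (i \in M) && (j \in M) then 1 else 0)).
  rewrite cE big_distrr/=; apply: ler_sum => K /is_cliqueP[Kt _].
  apply: (le_trans (y := \sum_(w in K) (if (i \in K) && (j \in K) then 1 else 0))).
    apply: ler_sum => w _; rewrite !inE.
    by case: (i \in K); case: (j \in K); rewrite ?andbF// !andbT; case: ifP.
  by rewrite sumr_const Kt mulr_natl.
apply: le_trans (ler_wpM2l _ IH) _; first by rewrite divr_ge0.
rewrite mulrAC ler_pdivrMr ?ltr0n//; apply: le_trans step _.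
by rewrite mulrC ler_wpM2l// ler_nat.
Qed.

(* Double counting of the pairs in [N(w) :&: K], with the integer inequality
   [t (t - 1) >= (r - 1) (2 t - r)]. *)
Lemma clique_codegree (R : realFieldType) n (G : sgraph n) (r : nat) K (D B : R) :
  (0 < r)%N -> is_clique G r.+1 K ->
  (forall v, v \in K -> D <= #|[set w | G v w]|%:R) ->
  (forall i j, i \in K -> j \in K -> i != j -> #|common_nbr G [set i; j]|%:R <= B) ->
  (r%:R - 1) * (2 * r.+1%:R * D - r%:R * n%:R) <= r.+1%:R * r%:R * B.
Proof.
move=> r0 /is_cliqueP[Kr _] degD codB.
pose g v w : R := (G v w)%:R.
have degE v : #|[set w | G v w]|%:R = \sum_w g v w.
  rewrite -sum1_card natr_sum big_mkcond/=; apply: eq_bigr => w _.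
  by rewrite inE /g; case: (G v w).
have codE i j : #|common_nbr G [set i; j]|%:R = \sum_w g i w * g j w.
  rewrite -sum1_card natr_sum big_mkcond/=; apply: eq_bigr => w _.
  rewrite /g -natrM mulnb; case: common_nbrP => [wij|wij].
    by rewrite !wij ?inE ?eqxx ?orbT.
  case: andP => // -[iw jw]; exfalso; apply: wij => v.
  by rewrite !inE => /orP[]/eqP->.
pose t w := \sum_(v in K) g v w.
have tN w : exists k : nat, t w = k%:R.
  by exists (\sum_(v in K) G v w)%N; rewrite natr_sum.
have gg v w : g v w * g v w = g v w by rewrite /g -natrM mulnb andbb.
have upper : \sum_w (t w * t w - t w) <= r.+1%:R * r%:R * B.
  have -> : \sum_w (t w * t w - t w) =
      \sum_(i in K) \sum_(j in K :\ i) #|common_nbr G [set i; j]|%:R.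
    rewrite (eq_bigr (fun w => \sum_(i in K) \sum_(j in K :\ i) g i w * g j w)).
      rewrite exchange_big/=; apply: eq_bigr => i _.
      by rewrite exchange_big/=; apply: eq_bigr => j _; rewrite codE.
    move=> w _; rewrite {1}/t big_distrl/= {2}/t -sumrB; apply: eq_bigr => i iK.
    by rewrite -big_distrr/= /t (big_setD1 i iK)/= mulrDr gg addrC addrA addNr add0r.
  apply: (le_trans (y := \sum_(i in K) \sum_(j in K :\ i) B)).
    apply: ler_sum => i iK; apply: ler_sum => j; rewrite !inE => /andP[ji jK].
    by apply: codB => //; rewrite eq_sym.
  rewrite (eq_bigr (fun=> r%:R * B)) => [|i iK]; last first.
    by rewrite sumr_const mulr_natl; congr (_ *+ _); have := cardsD1 i K; rewrite Kr iK => -[].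
  by rewrite sumr_const Kr -mulrA [leRHS]mulr_natl.
apply: le_trans upper.
have lower w : (r%:R - 1) * (2 * t w - r%:R) <= t w * t w - t w.
  have [k ->] := tN w; rewrite -subr_ge0.
  have -> : k%:R * k%:R - k%:R - (r%:R - 1) * (2 * k%:R - r%:R) =
     (r%:R - k%:R) * (r%:R - 1 - k%:R) :> R by ring.
  have [kr|rk] := leqP r k.
    by rewrite mulr_le0 ?subr_le0 ?ler_nat// -[leRHS]addr0 lerD ?ler_nat// lerN10.
  by rewrite mulr_ge0// ?subr_ge0 ?ler_nat ?(ltnW rk)// lerBrDr natr1 ler_nat.
apply: le_trans (ler_sum _ (fun w _ => lower w)).
rewrite -big_distrr/= sumrB -big_distrr/= sumr_const card_ord.
have St : r.+1%:R * D <= \sum_w t w.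
  rewrite exchange_big/= mulr_natl -Kr -sumr_const; apply: ler_sum => v vK.
  by rewrite -degE degD.
apply: ler_wpM2l; first by rewrite subr_ge0 ler1n.
by rewrite lerB ?[leRHS]mulr_natr// -mulrA ler_wpM2l.
Qed.

(** Averaging over the pairs in [K] finds an edge of large codegree, from which the greedy
    construction starts. *)
Lemma js_ge_min_degree (R : realFieldType) n (G : sgraph n) (r : nat) K :
  (2 <= r)%N -> is_clique G r.+1 K ->
  (forall v, (1 - r%:R^-1 - r%:R^-1 ^+ 5) * n%:R <= #|[set w | G v w]|%:R :> R) ->
  (r%:R^-1 ^+ 6 * n%:R) ^+ r.-1 <= (js G r.+1)%:R :> R.
Proof.
move=> r2 cK degG; set e := r%:R^-1 : R.
have r0 : 0 < r%:R :> R by rewrite ltr0n ltnW.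
have re : r%:R * e = 1 by rewrite mulfV// gt_eqF.
have e0 : 0 < e by rewrite invr_gt0.
have e2 : 2 * e <= 1 by rewrite -[leRHS]re ler_pM2r ?ler_nat.
set N : R := n%:R.
have N0 : 0 < N.
  rewrite ltr0n; have /is_cliqueP[Ks _] := cK.
  have := max_card (mem K); rewrite card_ord Ks; exact: leq_trans.
(* [T * N] equals a + (r - 2) b for the values a = e^4 N and b = (e + e^5) N given to [js_ge_greedy]
   below; the degree deficit e^5 is small enough for [clique_codegree] to reach it. *)
set T := 1 - 2 * e + 2 * e ^+ 4 - 2 * e ^+ 5.
have [i [j [iK jK ij Bij]]] : exists i j, [/\ i \in K, j \in K, i != j &
    T * N <= #|common_nbr G [set i; j]|%:R].
  apply: contrapT => noij.
  have codB i j : i \in K -> j \in K -> i != j ->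
      #|common_nbr G [set i; j]|%:R <= T * N.
    by move=> iK jK ij; rewrite leNgt; apply/negP => /ltW lt; apply: noij; exists i, j.
  have := clique_codegree (ltnW r2) cK (fun v _ => degG v) codB.
  rewrite -/e -/N.
  rewrite -[in r.+1%:R]addn1 natrD.
  rewrite -(ler_pM2r (exprn_gt0 2 e0)) leNgt => /negP; apply.
  have -> : (r%:R + 1) * r%:R * (T * N) * e ^+ 2 =
    (r%:R * e + e) * (r%:R * e) * T * N by ring.
  have -> : (r%:R - 1) * (2 * (r%:R + 1) * ((1 - e - e ^+ 5) * N) - r%:R * N) *
     e ^+ 2 = (r%:R * e - e) * (2 * (r%:R * e + e) * (1 - e - e ^+ 5) - r%:R * e) * N.
    by ring.
  rewrite re ltr_pM2r// -subr_gt0 /T.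
  rewrite (_ : _ - _ = 2 * e ^+ 3 * (1 - e - e ^+ 2 + e ^+ 3 + e ^+ 4)); last by ring.
  rewrite mulr_gt0 ?mulr_gt0 ?exprn_gt0//.
  have := exprn_gt0 3 e0; have := exprn_gt0 4 e0; nra.
have Gij : G i j by case/is_cliqueP : cK => _; apply.
case: r r2 cK degG @e r0 re e0 e2 @T Bij => [|[|s]]// _ cK degG e r0 re e0 e2 T Bij /=.
apply: le_trans (js_ge_greedy (a := e ^+ 4 * N) (b := (e + e ^+ 5) * N) Gij _ _ _ _).
- rewrite lerXn2r ?nnegrE ?mulr_ge0 ?divr_ge0 ?exprn_ge0 ?invr_ge0 ?(ltW e0) ?(ltW N0)//.
  rewrite ler_pdivlMr ?ltr0n// -[s.+3]addn1 natrD.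
  rewrite [leLHS](_ : _ = e ^+ 4 * N * (s.+2%:R * e * e + e ^+ 2)); last by ring.
  rewrite re ler_piMr ?mulr_ge0 ?exprn_ge0 ?(ltW e0) ?(ltW N0)//; nra.
- by rewrite mulr_ge0 ?exprn_ge0 ?(ltW e0) ?(ltW N0).
- by rewrite mulr_ge0 ?addr_ge0 ?exprn_ge0 ?(ltW e0) ?(ltW N0).
- move=> v; have := degG v; rewrite -/e -/N => dv.
  have : #|[set w | G v w]|%:R + #|[set w | ~~ G v w]|%:R = N :> R.
    rewrite -natrD /N; congr (_%:R).
    rewrite -[RHS]card_ord -(cardC (mem [set w | G v w])); congr addn.
    by apply: eq_card => w; rewrite !inE.
  lra.
- apply: le_trans Bij; rewrite [leLHS](_ : _ =
     (e ^+ 4 + (s.+2%:R * e - 2 * e) + (s.+2%:R * e - 2 * e) * e ^+ 4) * N).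
    rewrite re ler_pM2r// /T; lra.
  by rewrite -(addn2 s) natrD; ring.
Qed.

(** * The extremal vector *)

(** Convexity of the power, obtained from Young's inequality for z and s^(p-1) with the conjugate
    exponents p and p/(p-1). *)
Lemma powR_tangent (R : realType) (p z s : R) : 1 < p -> 0 <= z -> 0 <= s ->
  s `^ p + p * s `^ (p - 1) * (z - s) <= z `^ p.
Proof.
move=> p1 z0 s0; have p0 : 0 < p by lra.
have q0 : 0 < p / (p - 1) by rewrite divr_gt0// subr_gt0.
have pq : p^-1 + (p / (p - 1))^-1 = 1.
  by rewrite invf_div -[X in X + _]mul1r -mulrDl addrC subrK divff// gt_eqF.
have := conjugate_powR z0 (powR_ge0 s (p - 1)) p0 q0 pq.
rewrite -powRrM mulrCA mulfV ?subr_eq0 ?gt_eqF// mulr1 => le.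
have : s * s `^ (p - 1) = s `^ p by rewrite mulr_powRB1.
move: le; rewrite -(ler_pM2l p0).
rewrite (_ : p * (_ + _) = z `^ p + (p - 1) * s `^ p); last first.
  by rewrite invf_div mulrDr; field; rewrite gt_eqF.
move=> le E; rewrite mulrBr -[_ * s]mulrA [X in _ - _ * X]mulrC E; lra.
Qed.

(* The weak inequality at [sqrt (z / s)], once squared, is strict at [z / s]. *)
Lemma powR_tangent_lt (R : realType) (p z s : R) : 1 < p -> 0 <= z -> 0 <= s ->
  z != s -> s `^ p + p * s `^ (p - 1) * (z - s) < z `^ p.
Proof.
move=> p1 z0; rewrite le_eqVlt => /predU1P[<- z1|s0 zs].
  rewrite !powR0 ?gt_eqF ?subr_gt0//; last by lra.
  by rewrite mulr0 mul0r addr0 powR_gt0// lt_neqAle eq_sym z1.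
set k := Num.sqrt (z / s).
have k0 : 0 <= k by exact: sqrtr_ge0.
have zE : z = s * (k * k).
  by rewrite -expr2 sqr_sqrtr ?divr_ge0 ?(ltW s0)// mulrC divfK// gt_eqF.
have k1 : k != 1 by apply: contraNneq zs => k1; rewrite zE k1 !mulr1.
have sE : s `^ (p - 1) * s = s `^ p by rewrite mulrC mulr_powRB1// ?(ltW s0)//; lra.
have -> : z `^ p = s `^ p * (k `^ p * k `^ p) by rewrite zE !powRM ?mulr_ge0 ?(ltW s0).
have -> : s `^ p + p * s `^ (p - 1) * (z - s) = s `^ p * (1 + p * (k * k - 1)).
  by rewrite zE -sE; ring.
rewrite ltr_pM2l ?powR_gt0//.
have := powR_tangent p1 k0 ler01; rewrite !powR1 mulr1; set w := k `^ p => kw.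
have w0 : 0 <= w by exact: powR_ge0.
have k2 : 0 < (k - 1) ^+ 2 by rewrite lt_neqAle sqr_ge0 andbT eq_sym sqrf_eq0 subr_eq0.
have [pos|neg] := lerP 0 (1 + p * (k - 1)).
  apply: (lt_le_trans (y := (1 + p * (k - 1)) * (1 + p * (k - 1)))); last first.
    by apply: ler_pM.
  rewrite -subr_gt0 (_ : _ - _ = p * (p - 1) * (k - 1) ^+ 2); last by ring.
  by rewrite mulr_gt0// mulr_gt0//; lra.
apply: lt_le_trans (mulr_ge0 w0 w0).
have : k * (p * (k - 1)) <= 0.
  by rewrite mulr_ge0_le0//; lra.
rewrite (_ : 1 + p * (k * k - 1) = 1 + p * (k - 1) + k * (p * (k - 1))); last by ring.
lra.
Qed.

(** Power-mean inequality: the tangents at the mean [s] are added up, and their linear terms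
    cancel. *)
Lemma powR_sum_le (R : realType) (p : R) (I : finType) (P : pred I) (z : I -> R) :
  1 < p -> (forall i, 0 <= z i) ->
  (\sum_(i | P i) z i) `^ p <=
  #|[pred i | P i]|%:R `^ (p - 1) * \sum_(i | P i) z i `^ p.
Proof.
move=> p1 z0; set N := #|_|.
have [N0|N0] := posnP N.
  rewrite big_pred0 => [|i]; last by have := card0_eq N0 i; rewrite inE.
  by rewrite powR0 ?mulr_ge0 ?powR_ge0 ?sumr_ge0// => [i|]; rewrite ?powR_ge0// gt_eqF//; lra.
have N0' : 0 < N%:R :> R by rewrite ltr0n.
set S := \sum_(i | P i) z i; have S0 : 0 <= S by exact: sumr_ge0.
set s := S / N%:R; have s0 : 0 <= s by rewrite divr_ge0.
have -> : S = N%:R * s by rewrite mulrC divfK ?gt_eqF.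
rewrite powRM// -(mulr_powRB1 (ltW N0')) ?[N%:R * _]mulrC; last by lra.
rewrite -mulrA ler_wpM2l ?powR_ge0//.
apply: (le_trans (y := \sum_(i | P i) (s `^ p + p * s `^ (p - 1) * (z i - s)))); last first.
  by apply: ler_sum => i _; exact: powR_tangent.
rewrite big_split/= -big_distrr/= sumrB !sumr_const -/N -/S.
by rewrite -[s *+ N]mulr_natr divfK ?gt_eqF// subrr mulr0 addr0 mulr_natl.
Qed.

Definition wdeg (R : realType) n (G : sgraph n) (x : 'I_n -> R) i :=
  \sum_(j | G i j) x j.

(** Summing over ordered pairs gives the value of [lagr] (see [lagrE]) without using the order of
    the vertices. *)
Definition qform (R : realType) n (G : sgraph n) (x : 'I_n -> R) :=
  \sum_i x i * wdeg G x i.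

Lemma wdeg_ge0 (R : realType) n (G : sgraph n) (x : 'I_n -> R) i :
  (forall i, 0 <= x i) -> 0 <= wdeg G x i.
Proof. by move=> x0; exact: sumr_ge0. Qed.

Lemma qform_ge0 (R : realType) n (G : sgraph n) (x : 'I_n -> R) :
  (forall i, 0 <= x i) -> 0 <= qform G x.
Proof. by move=> x0; apply: sumr_ge0 => i _; rewrite mulr_ge0// wdeg_ge0. Qed.

Lemma lagrE (R : realType) n (G : sgraph n) (x : 'rV[R]_n) :
  lagr G x = qform G (x 0).
Proof.
rewrite /lagr /qform mulr_natl mulr2n.
rewrite [X in _ + X](exchange_big_dep xpredT)//=.
under [RHS]eq_bigr => i _.
  rewrite /wdeg big_distrr/= (bigID (fun j : 'I_n => (i < j)%N))/=.
  over.
rewrite big_split/=; congr (_ + _).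
  by apply: eq_bigr => i _; apply: eq_bigl => j; rewrite andbC.
apply: eq_bigr => i _; apply: eq_big => [j|j _]; last exact: mulrC.
rewrite adj_sym andbC -leqNgt [in RHS]leq_eqVlt.
case: (boolP (G i j)) => //= Gij.
by case: eqP => //= ji; move: Gij; rewrite (ord_inj ji) adj_irr.
Qed.

Lemma qformZ (R : realType) n (G : sgraph n) (x : 'I_n -> R) k :
  qform G (fun i => k * x i) = k ^+ 2 * qform G x.
Proof.
rewrite /qform big_distrr; apply: eq_bigr => i _ /=.
by rewrite /wdeg -big_distrr/=; ring.
Qed.

Lemma qform_set (R : realType) n (G : sgraph n) (x : 'I_n -> R) v a :
  qform G (fun i => if i == v then a else x i) =
  qform G x + 2 * (a - x v) * wdeg G x v.
Proof.
set d := a - x v.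
have wE i : wdeg G (fun i => if i == v then a else x i) i =
    wdeg G x i + (if G v i then d else 0).
  rewrite /wdeg [G v i]adj_sym; case: ifP => Giv.
    rewrite (bigD1 v)//= eqxx [in RHS](bigD1 v)//= (eq_bigr x) => [|j].
      by rewrite /d; ring.
    by move=> /andP[_ /negPf->].
  rewrite addr0; apply: eq_bigr => j Gij; case: eqP => // jv.
  by move: Gij; rewrite jv Giv.
rewrite {1}/qform (bigD1 v)//= eqxx wE adj_irr addr0.
rewrite (eq_bigr (fun i => x i * wdeg G x i + d * (if G v i then x i else 0))); last first.
  move=> i /negPf->; rewrite wE mulrDr; congr (_ + _).
  by case: ifP => _; rewrite ?mulr0// mulrC.
rewrite big_split/= -big_distrr/= /qform [in RHS](bigD1 v)//=.
have -> : \sum_(i < n | i != v) (if G v i then x i else 0) = wdeg G x v.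
  rewrite -big_mkcondr/=; apply: eq_bigl => i; case: eqP => // ->.
  by rewrite adj_irr.
by rewrite /d; ring.
Qed.

(** Absolute values keep the p-norm and do not decrease the form, so an extremal vector may be taken
    nonnegative. *)
Lemma spectral_pair (R : realType) (p : R) n (G : sgraph n) : 1 < p -> (0 < n)%N ->
  exists x : 'I_n -> R, [/\ forall i, 0 <= x i, \sum_i x i `^ p = 1 &
    pspectral_radius p G = qform G x].
Proof.
move=> p1 n0; have p0 : 0 < p by lra.
have [x [xS xE xmax]] := pspectral_radius_max G p0 n0.
pose y : 'rV[R]_n := \row_i `|x 0 i|.
have yS : psphere p n y.
  rewrite /psphere/= -[X in _ = X]xS; apply: eq_bigr => i _.
  by rewrite mxE normr_id.
exists (fun i => `|x 0 i|); split=> //.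
apply/eqP; rewrite eq_le; apply/andP; split.
  rewrite xE lagrE; apply: ler_sum => i _.
  rewrite /wdeg !big_distrr/=; apply: ler_sum => j _.
  by rewrite -normrM ler_norm.
rewrite xE; apply: le_trans (xmax _ yS); rewrite lagrE le_eqVlt; apply/orP; left.
apply/eqP/eq_bigr => i _; rewrite mxE; congr (_ * _); apply: eq_bigr => j _.
by rewrite mxE.
Qed.

(** Homogeneous form of maximality, which allows test vectors that are not normalized. *)
Lemma spectral_ub (R : realType) (p : R) n (G : sgraph n) (z : 'I_n -> R) :
  1 < p -> (0 < n)%N -> (forall i, 0 <= z i) ->
  qform G z <= pspectral_radius p G * (\sum_i z i `^ p) `^ (2 / p).
Proof.
move=> p1 n0 z0; have p0 : 0 < p by lra.
have [x [xS -> xmax]] := pspectral_radius_max G p0 n0.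
set N := \sum_i _; have N0 : 0 <= N by apply: sumr_ge0 => i _; exact: powR_ge0.
have [N0'|N0'] := eqVneq N 0.
  rewrite N0' powR0 ?mulr0 ?mulf_neq0 ?invr_neq0 ?gt_eqF//.
  rewrite /qform big1// => i _; have := psumr_eq0P (fun i _ => powR_ge0 (z i) p) N0'.
  by move=> /(_ i isT)/powR_eq0_eq0->; rewrite mul0r.
have Np : 0 < N by rewrite lt_neqAle eq_sym N0'.
set k := N `^ p^-1; have k0 : 0 < k by exact: powR_gt0.
have kp : k `^ p = N by rewrite -powRrM mulVf ?powRr1 ?gt_eqF.
pose y : 'rV[R]_n := \row_i (k^-1 * z i).
have yS : psphere p n y.
  rewrite /psphere/= (eq_bigr (fun i => N^-1 * z i `^ p)) => [|i _].
    by rewrite -big_distrr/= mulVf ?gt_eqF.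
  rewrite mxE ger0_norm ?mulr_ge0 ?invr_ge0 ?(ltW k0)// powRM ?invr_ge0 ?(ltW k0)//.
  by congr (_ * _); rewrite -powR_inv1 ?(ltW k0)// powRAC kp powR_inv1.
have := xmax _ yS; rewrite lagrE.
have -> : qform G (y 0) = qform G (fun i => k^-1 * z i).
  apply: eq_bigr => i _; rewrite mxE; congr (_ * _); apply: eq_bigr => j _.
  by rewrite mxE.
rewrite qformZ exprVn mulrC ler_pdivrMr ?exprn_gt0//.
by rewrite -powR_mulrn ?(ltW k0)// /k -powRrM [2 / p]mulrC.
Qed.

Lemma spectral_ge0 (R : realType) (p : R) n (G : sgraph n) :
  1 < p -> (0 < n)%N -> 0 <= pspectral_radius p G.
Proof.
by move=> p1 n0; have [x [x0 _ ->]] := spectral_pair G p1 n0; exact: qform_ge0.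
Qed.

(** The Lagrange condition, found by varying the single coordinate x_v: by [spectral_ub] a function
    of one variable is minimal at x_v. It is differentiated there if x_v > 0; if x_v = 0, orders of
    magnitude are compared. *)
Lemma eigenequation (R : realType) (p : R) n (G : sgraph n) (x : 'I_n -> R) v :
  1 < p -> (forall i, 0 <= x i) -> \sum_i x i `^ p = 1 ->
  pspectral_radius p G = qform G x ->
  wdeg G x v = pspectral_radius p G * x v `^ (p - 1).
Proof.
move=> p1 x0 xS xE; have p0 : 0 < p by lra.
have n0 : (0 < n)%N by exact: leq_ltn_trans (ltn_ord v).
have lam0 := spectral_ge0 G p1 n0.
set lam := pspectral_radius p G in xE lam0 *.
have D0 := wdeg_ge0 G v x0; set D := wdeg G x v in D0 *.
set a := x v; have a0 : 0 <= a by exact: x0.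
set c := 1 - a `^ p.
have cE : \sum_(i < n | i != v) x i `^ p = c.
  by move: xS; rewrite (bigD1 v)//= -/a /c; lra.
have c0 : 0 <= c.
  by rewrite -cE; apply: sumr_ge0 => i _; exact: powR_ge0.
have key (t : R) : 0 <= t -> lam + 2 * (t - a) * D <= lam * (c + t `^ p) `^ (2 / p).
  move=> t0; have := @spectral_ub R p n G (fun i => if i == v then t else x i) p1 n0.
  rewrite qform_set -xE; move=> /(_ _)/le_trans; apply.
    by move=> i; case: ifP.
  rewrite (bigD1 v)//= eqxx (eq_bigr (fun i => x i `^ p)) => [|i /negPf->//].
  by rewrite cE addrC.
have [a1|a1] := eqVneq a 0; last first.
  have {}a1 : 0 < a by rewrite lt_neqAle eq_sym a1.
  pose h (t : R) := lam * (c + t `^ p) `^ (2 / p) - 2 * (t - a) * D.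
  have dh (t : R) : 0 < t -> is_derive t 1 h
      (lam * ((2 / p) * (c + t `^ p) `^ (2 / p - 1) * (p * t `^ (p - 1))) - 2 * D).
    move=> t0; have d1 := is_derive1_powR p t0.
    have ct : 0 < c + t `^ p by rewrite ltr_wpDl// powR_gt0.
    have d2 : is_derive t 1 (fun t : R => c + t `^ p) (0 + p * t `^ (p - 1)).
      exact: is_deriveD.
    have d3 := @is_derive1_comp R _ _ t _ _ (is_derive1_powR (2 / p) ct) d2.
    have d4 := is_deriveZ lam d3.
    have d5 := is_deriveZ (2 * D) (is_deriveB (is_derive_id t (1 : R)) (is_derive_cst a t (1 : R))).
    have d6 := is_deriveB d4 d5.
    rewrite (_ : h = (lam \*: ((@powR R)^~ (2 / p) \o (fun t : R => c + t `^ p))) -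
       ((2 * D) \*: (id - cst a : R -> R))); last first.
      by apply/funext => u; rewrite /h -[RHS]/(lam * _ - 2 * D * (u - a)) /=; ring.
    apply: is_derive_eq d6 _.
    by rewrite add0r subr0 /GRing.scale/= mulr1.
  have hmin (t : R) : t \in `]0, 2 * a[ -> h a <= h t.
    rewrite in_itv/= => /andP[t0 _]; have := key t (ltW t0).
    have -> : h a = lam by rewrite /h subrr mulr0 mul0r subr0 /c subrK powR1 mulr1.
    by rewrite -lerBrDr.
  have a_in : a \in `]0, 2 * a[ by rewrite in_itv/=; apply/andP; split; lra.
  have h0 := @derive1_at_min R h 0 (2 * a) a.
  have {}h0 : is_derive a 1 h 0.
    apply: h0 => //; first by lra.
    by move=> t; rewrite in_itv/= => /andP[/dh[]].
  have [_ e1] := dh a a1; have [_ e2] := h0; move: e1; rewrite e2.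
  rewrite /c subrK powR1 mulr1.
  have pp : 2 / p * p = 2 by rewrite divfK// gt_eqF.
  rewrite [2 / p * (p * _)]mulrA pp; lra.
rewrite a1 powR0 ?mulr0 ?subr_eq0 ?gt_eqF//.
apply/eqP; rewrite eq_le D0 andbT leNgt; apply/negP => Dp.
(* Raising x_v from 0 to t gains 2 t D, whereas the norm costs a multiple of t^p = t tau, where tau
   = t^(p-1). This [tau] is at most 1 and makes 3 lam tau < 2 D. *)
set tau := D / (D + 2 * lam + 1).
have den0 : 0 < D + 2 * lam + 1 by lra.
have tau0 : 0 < tau by exact: divr_gt0.
have tau1 : tau <= 1 by rewrite ler_pdivrMr// mul1r; lra.
set t := tau `^ (p - 1)^-1.
have t0 : 0 < t by exact: powR_gt0.
have tp : t `^ (p - 1) = tau.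
  by rewrite -powRrM mulVf ?powRr1 ?(ltW tau0)// subr_eq0 gt_eqF.
have tpE : t `^ p = t * tau by rewrite -tp mulr_powRB1 ?(ltW t0).
have t1 : t <= 1.
  by rewrite -[leRHS](powRr0 tau) ger_powR ?tau0//= invr_ge0 subr_ge0 ltW.
set s := t `^ p; have s0 : 0 <= s by exact: powR_ge0.
have s1 : s <= 1 by rewrite /s tpE; nra.
have := key t (ltW t0); rewrite a1 /c a1 powR0 ?gt_eqF// !subr0 -/s => k.
have : (1 + s) `^ (2 / p) <= 1 + 3 * s.
  apply: (le_trans (y := (1 + s) `^ 2)).
    by rewrite ler_powR; [|lra|rewrite ler_pdivrMr//; lra].
  by rewrite powR_mulrn; nra.
move=> /(ler_wpM2l lam0)/(le_trans k); rewrite /s tpE => le.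
have {}le : 2 * D <= lam * 3 * tau by rewrite -(ler_pM2l t0); lra.
have : lam * 3 * tau < 2 * D; last by move=> /lt_le_trans/(_ le); rewrite ltxx.
rewrite /tau mulrA ltr_pdivrMr//; nra.
Qed.

(** * The spectral Turan theorem *)

(* Erdos's degree majorization, weighted: the non-neighbours of a vertex of
   maximum weighted degree form one colour class, and one recurses into its
   neighbourhood. *)
Lemma degree_majorization (R : realType) n (G : sgraph n) (x : 'I_n -> R) r
    (S : {set 'I_n}) : (forall i, 0 <= x i) ->
  (forall K : {set 'I_n}, K \subset S -> ~~ is_clique G r.+1 K) ->
  exists c : 'I_n -> nat, [/\ forall i, i \in S -> (c i < r)%N,
    forall i, i \in S ->
      \sum_(j in S | G i j) x j <= \sum_(j in S | c i != c j) x j &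
    (forall i, 0 < x i) -> (forall i, i \in S ->
      \sum_(j in S | G i j) x j = \sum_(j in S | c i != c j) x j) ->
    {in S &, forall i j, G i j = (c i != c j)}].
Proof.
move=> x0; elim: r S => [|r IH] S clS.
  have S0 i : i \in S = false.
    apply/negP => iS; have := clS [set i]; rewrite sub1set => /(_ iS)/negP; apply.
    apply/is_cliqueP; split; first by rewrite cards1.
    by move=> a b; rewrite !inE => /eqP-> /eqP->; rewrite eqxx.
  by exists (fun=> 0%N); split=> [i|i|_ _ i j]; rewrite S0.
have [->|[v0 v0S]] := set_0Vmem S.
  by exists (fun=> 0%N); split=> [i|i|_ _ i j]; rewrite inE.
pose D i := \sum_(j in S | G i j) x j.
have [v vS vmax] : exists2 v, v \in S & forall i, i \in S -> D i <= D v.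
  by case: (@Order.TotalTheory.arg_maxP _ _ _ v0 (mem S) D v0S) => v vS vm; exists v.
pose N := [set j in S | G v j].
have NS j : j \in N -> j \in S by rewrite inE => /andP[].
have [|c [cr cD ceq]] := IH N.
  move=> K KN; apply/negP => Kcl; have vKS : v |: K \subset S.
    rewrite subUset sub1set vS/=; apply/fintype.subsetP => j jK.
    by apply: NS; exact: (fintype.subsetP KN).
  have vK : v \notin K.
    by apply/negP => /(fintype.subsetP KN); rewrite inE adj_irr andbF.
  have /negP := clS _ vKS; apply; rewrite is_clique_setU1// Kcl/=; apply/common_nbrP => j /(fintype.subsetP KN).
  by rewrite inE adj_sym => /andP[].
(* The vertices of [N] keep their recursive colours, all below r; the rest of [S] gets the new
   colour r. *)
pose c' i := if i \in N then c i else r.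
have split P : \sum_(j in S | P j) x j =
    \sum_(j in N | P j) x j + \sum_(j in S :\: N | P j) x j.
  rewrite (bigID (mem N))/=; congr (_ + _); apply: eq_bigl => j; rewrite !inE.
    by case: (j \in S); case: (P j); case: (G v j).
  by case: (j \in S); case: (P j); case: (G v j).
have cN i : i \in N -> \sum_(j in N | c' i != c' j) x j = \sum_(j in N | c i != c j) x j.
  move=> iN; apply: eq_bigl => j; rewrite /c' iN.
  by case: (boolP (j \in N)).
have cT i : i \in N -> \sum_(j in S :\: N | c' i != c' j) x j = \sum_(j in S :\: N) x j.
  move=> iN; apply: eq_bigl => j; rewrite /c' iN inE.
  case: (boolP (j \in N)) => //= jN; rewrite neq_ltn cr// andbT//.
have TN i : i \in S :\: N -> \sum_(j in S | c' i != c' j) x j = D v.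
  rewrite inE => /andP[iN iS]; rewrite split [X in _ + X]big1 => [|j].
    rewrite addr0 /D; apply: eq_bigl => j; rewrite /c' (negPf iN).
    case: (boolP (j \in N)) => jN/=.
      by rewrite neq_ltn cr// orbT; move: jN; rewrite inE => ->.
    by apply/esym; move: jN; rewrite inE => /negPf->.
  by rewrite inE /c' (negPf iN) => /andP[/andP[/negPf-> _]]; rewrite eqxx.
have TI i : i \in S -> i \notin N -> i \in S :\: N.
  by move=> iS iN; rewrite in_setD iN.
exists c'; split=> [i iS|i iS|xp eqD i j iS jS].
- by rewrite /c'; case: ifP => // /cr; exact: ltnW.
- have [iN|iN] := boolP (i \in N); last first.
    by rewrite TN ?TI//; exact: vmax.
  rewrite !split cN// cT// lerD ?cD//.
  by rewrite [leRHS](bigID (G i))/= lerDl sumr_ge0.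
have zero (P : pred 'I_n) : \sum_(j | P j) x j = 0 -> forall j, P j = false.
  move=> P0 k; apply/negP => Pk.
  have := psumr_eq0P (fun i _ => x0 i) P0 Pk; have := xp k; lra.
(* Equality at a vertex of [N] makes two bounds tight: the recursive one inside [N], and the one by
   the full weight of S minus N. *)
have [eqN eqT] : (forall i, i \in N -> \sum_(j in N | G i j) x j =
      \sum_(j in N | c i != c j) x j) /\
    (forall i j, i \in N -> j \in S :\: N -> G i j).
  suff H k : k \in N -> \sum_(j in N | G k j) x j =
      \sum_(j in N | c k != c j) x j /\ \sum_(j in S :\: N | ~~ G k j) x j = 0.
    split=> [k /H[]//|k l /H[_ /zero/(_ l)]].
    by move=> + lT; rewrite lT/= => /negbFE.
  move=> kN; have := eqD k (NS k kN); rewrite !split cN// cT//.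
  rewrite [X in _ = _ + X](bigID (G k))/=.
  have := cD k kN; have : 0 <= \sum_(j in S :\: N | ~~ G k j) x j by exact: sumr_ge0.
  by move=> ? ? ?; split; lra.
have {}ceq := ceq xp eqN.
(* A vertex of S minus N sees all of [N], whose weight [D v] already exhausts its degree, so it has
   no neighbour in S minus N. *)
have TT i' j' : i' \in S :\: N -> j' \in S :\: N -> G i' j' = false.
  move=> iT jT; have iS' : i' \in S by move: iT; rewrite inE => /andP[].
  have := eqD i' iS'; rewrite TN// split /D.
  have -> : \sum_(j in N | G i' j) x j = \sum_(j in S | G v j) x j.
    apply: eq_bigl => k; rewrite -[RHS](in_set (fun k => (k \in S) && G v k)) -/N.
    by case: (boolP (k \in N)) => //= kN; rewrite adj_sym eqT.
  move=> E; have /zero/(_ j') : \sum_(j in S :\: N | G i' j) x j = 0 by lra.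
  by rewrite jT.
have [iN|iN] := boolP (i \in N); have [jN|jN] := boolP (j \in N).
- by rewrite /c' iN jN ceq.
- by rewrite /c' iN (negPf jN) eqT ?TI// neq_ltn cr.
- by rewrite /c' jN (negPf iN) adj_sym eqT ?TI// neq_ltn cr// orbT.
- by rewrite /c' (negPf jN) (negPf iN) eqxx TT ?TI.
Qed.

(** * Balanced colourings and complete r-partite graphs *)

Lemma exists_perm (N : nat) (T : eqType) (f g : 'I_N -> T) :
  (forall y, #|[pred i | f i == y]| = #|[pred i | g i == y]|) ->
  exists s : 'S_N, forall i, f i = g (s i).
Proof.
move=> fg; have : perm_eq [tuple f i | i < N] [tuple g i | i < N].
  apply/seq.allP => y _ /=; apply/eqP.
  have E (h : 'I_N -> T) : count_mem y [tuple h i | i < N] = #|[pred i | h i == y]|.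
    rewrite -sum1_count big_tuple -sum1_card; apply: eq_bigl => i.
    by rewrite tnth_mktuple inE.
  by rewrite !E fg.
move=> /tuple_permP[s sE]; exists s => i.
have : tnth [tuple f i | i < N] i = tnth [tuple tnth [tuple g i | i < N] (s i) | i < N] i.
  by congr tnth; apply: val_inj.
by rewrite !tnth_mktuple.
Qed.

(** Let m0 be the least size and B the set of parts of size m0 + 1. Then n = m0 r + |B|, and |B| < r
    because a smallest part is not in B, so this is Euclidean division of n by r. *)
Lemma balanced_count r n (nu : 'I_r -> nat) y : (0 < r)%N ->
  (\sum_k nu k)%N = n -> (forall k l, nu k <= (nu l).+1)%N ->
  #|[pred k | nu k == y]| =
  if (y == n %/ r)%N then (r - n %% r)%N else
  if (y == (n %/ r).+1)%N then (n %% r)%N else 0%N.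
Proof.
move=> r0 nun bal; have k00 := Ordinal r0.
have [k0 _ kmin] := @arg_minnP _ k00 xpredT nu isT.
set m0 := nu k0 in kmin; pose B := [pred k | nu k == m0.+1].
have nuE k : nu k = (m0 + B k)%N.
  have := kmin k isT; have := bal k k0; rewrite -/m0 /B/=.
  by case: eqP => /=; lia.
have Br : (#|B| < r)%N.
  rewrite -[X in (_ < X)%N]card_ord; apply: proper_card; apply/properP; split.
    exact/fintype.subsetP.
  by exists k0; rewrite // inE -/m0; lia.
have nE : n = (m0 * r + #|B|)%N.
  rewrite -nun (eq_bigr _ (fun k _ => nuE k)) big_split/= sum_nat_const card_ord mulnC.
  congr addn; rewrite -sum1_card [RHS]big_mkcond/=; apply: eq_bigr => k _.
  by rewrite unfold_in /=; case: eqP.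
have -> : (n %/ r)%N = m0 by rewrite nE divnMDl// divn_small// addn0.
have -> : (n %% r)%N = #|B| by rewrite nE modnMDl modn_small.
case: eqP => [->|y1].
  rewrite -[X in (X - _)%N](card_ord r) -(cardC B) addKn; apply: eq_card => k; rewrite !inE.
  by have := nuE k; rewrite /B/=; case: (nu k == m0.+1) => /= E; apply/eqP; lia.
case: eqP => [->//|y2]; apply: eq_card0 => k; rewrite inE nuE.
by apply/eqP; case: (B k) => /=; lia.
Qed.

Lemma cgraph_sym n r (c : {ffun 'I_n -> 'I_r}) : symmetric (fun i j => c i != c j).
Proof. by move=> i j; rewrite eq_sym. Qed.

Lemma cgraph_irr n r (c : {ffun 'I_n -> 'I_r}) : irreflexive (fun i j => c i != c j).
Proof. by move=> i; rewrite eqxx. Qed.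

(** Colour classes may be empty. The colouring is a finite function so that one of maximal spectral
    radius exists. *)
Definition cgraph n r (c : {ffun 'I_n -> 'I_r}) : sgraph n :=
  SGraph (cgraph_sym c) (cgraph_irr c).

Lemma cgraph_turan n r (r0 : (0 < r)%N) :
  graph_iso (turan r n) (cgraph [ffun i : 'I_n => Ordinal (ltn_pmod i r0)]).
Proof. by exists 1%g => i j; rewrite /= !perm1 !ffunE. Qed.

Lemma graph_iso_sym n (G H : sgraph n) : graph_iso G H -> graph_iso H G.
Proof.
move=> [s sE]; exists s^-1%g => i j.
by rewrite sE !permKV.
Qed.

Lemma card_fibers n r (c : 'I_n -> 'I_r) : (\sum_k #|[pred i | c i == k]|)%N = n.
Proof.
under eq_bigr do rewrite -sum1_card.
rewrite -[RHS]card_ord -sum1_card (partition_big c xpredT)//=.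
Qed.

(** Permuting the colours matches the class sizes with those of the Turan colouring; permuting the
    vertices then matches the classes. *)
Lemma balanced_turan n r (c : {ffun 'I_n -> 'I_r}) : (0 < r)%N ->
  (forall k l, #|[pred i | c i == k]| <= #|[pred i | c i == l]|.+1)%N ->
  graph_iso (cgraph c) (turan r n).
Proof.
move=> r0 bal; pose c0 (i : 'I_n) := Ordinal (ltn_pmod i r0).
have c0E k : #|[pred i | c0 i == k]| = (n %/ r + (k < n %% r))%N.
  by rewrite -turan_part_size//; apply: eq_card => i; rewrite !inE.
have [|tau tauE] := @exists_perm r nat (fun k => #|[pred i | c i == k]|)
    (fun k => #|[pred i | c0 i == k]|).
  move=> y; rewrite (balanced_count y r0 (card_fibers c) bal).
  rewrite (balanced_count y r0 (card_fibers c0))// => k l; rewrite !c0E.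
  by case: (k < _)%N; case: (l < _)%N; rewrite ?addn0 ?addn1// ltnW.
have [|s sE] := @exists_perm n _ (fun i => tau (c i)) c0.
  move=> k; rewrite -[k](permKV tau) -tauE; apply: eq_card => i.
  by rewrite !inE (inj_eq perm_inj).
exists s => i j; rewrite /= -(inj_eq (@perm_inj _ tau)) !sE.
by rewrite -val_eqE.
Qed.

Lemma spectral_iso (R : realType) (p : R) n (G H : sgraph n) : 1 < p -> (0 < n)%N ->
  graph_iso G H -> pspectral_radius p G <= pspectral_radius p H.
Proof.
move=> p1 n0 [s sE]; have [x [x0 xS ->]] := spectral_pair G p1 n0.
have := spectral_ub H p1 n0 (fun i => x0 (s^-1%g i)).
rewrite (reindex_inj (@perm_inj _ s))/= (eq_bigr (fun i => x i `^ p)) => [|i _].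
  rewrite xS powR1 mulr1; apply: le_trans; rewrite le_eqVlt; apply/orP; left.
  apply/eqP; rewrite /qform [RHS](reindex_inj (@perm_inj _ s))/=.
  apply: eq_bigr => i _; rewrite permK; congr (_ * _).
  rewrite /wdeg [RHS](reindex_inj (@perm_inj _ s))/=.
  by apply: eq_big => [j|j _]; rewrite ?sE ?permK.
by rewrite permK.
Qed.

(** The form depends on [x] only through its block sums, so the weights inside a block can be
    redistributed freely. *)
Lemma qform_cgraph (R : realType) n r (c : {ffun 'I_n -> 'I_r}) (x : 'I_n -> R) :
  qform (cgraph c) x =
  (\sum_i x i) ^+ 2 - \sum_k (\sum_(i | c i == k) x i) ^+ 2.
Proof.
have -> : \sum_k (\sum_(i | c i == k) x i) ^+ 2 =
    \sum_i x i * \sum_(j | c i == c j) x j.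
  rewrite (partition_big c xpredT)//=; apply: eq_bigr => k _.
  rewrite expr2 big_distrl/=; apply: eq_bigr => i /eqP->; congr (_ * _).
  by apply: eq_bigl => j; rewrite eq_sym.
rewrite expr2 big_distrl/= -sumrB; apply: eq_bigr => i _; rewrite -mulrBr.
congr (_ * _); rewrite /wdeg [in RHS](bigID (fun j => c i == c j))/=.
by rewrite addrAC subrr add0r.
Qed.

(* If the block sums [X_A], [X_B] can be kept after the move without making
   the values in the first block larger than those in the second, the p-norm
   drops; otherwise spreading the total sum evenly moves the two block sums
   strictly closer to each other. *)
Lemma rebalance (R : realType) (p : R) (I : finType) (A B : {set I}) (x : I -> R) :
  1 < p -> (forall i, 0 < x i) -> (#|B|.+2 <= #|A|)%N ->
  let XA := \sum_(i in A) x i in let XB := \sum_(i in B) x i in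
  let MA := \sum_(i in A) x i `^ p in let MB := \sum_(i in B) x i `^ p in
  let a := #|A|.-1%:R in let b := #|B|.+1%:R in
  exists al be : R, [/\ 0 <= al, 0 <= be, a * al + b * be = XA + XB &
    ((a * al) ^+ 2 + (b * be) ^+ 2 <= XA ^+ 2 + XB ^+ 2 /\
     a * al `^ p + b * be `^ p < MA + MB) \/
    ((a * al) ^+ 2 + (b * be) ^+ 2 < XA ^+ 2 + XB ^+ 2 /\
     a * al `^ p + b * be `^ p <= MA + MB)].
Proof.
move=> p1 xp AB XA XB MA MB a b.
have aE : #|A|%:R = a + 1 by rewrite natr1 prednK//; exact: leq_ltn_trans AB.
have bE : #|B|%:R = b - 1 by rewrite /b -natr1 addrK.
have a0 : 0 < a by rewrite ltr0n; case: #|A| AB => [|[|]].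
have b0 : 0 < b by [].
have ab : b <= a by rewrite ler_nat; case: #|A| AB.
have XA0 : 0 < XA.
  have [i iA] : exists i, i \in A by apply/set0Pn; rewrite -card_gt0; case: #|A| AB.
  by rewrite /XA (bigD1 i)//= ltr_pwDl// sumr_ge0// => j _; exact: ltW.
have XB0 : 0 <= XB by apply: sumr_ge0 => j _; exact: ltW.
have tang (C : {set I}) (s : R) : 0 <= s ->
    #|C|%:R * s `^ p + p * s `^ (p - 1) * (\sum_(i in C) x i - #|C|%:R * s) <=
    \sum_(i in C) x i `^ p.
  move=> s0; rewrite !mulr_natl -!sumr_const -sumrB big_distrr -big_split/=.
  by apply: ler_sum => i _; apply: powR_tangent => //; exact: ltW.
have [le|gt] := lerP (XA / a) (XB / b).
  have al0 : 0 < XA / a by exact: divr_gt0.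
  exists (XA / a), (XB / b); rewrite ![_ * (_ / _)]mulrC !divfK ?gt_eqF//.
  split=> //; [exact: ltW|exact: le_trans (ltW al0) le|left; split=> //].
  set al := XA / a in le al0 *; set be := XB / b in le *.
  have be0 : 0 < be by exact: lt_le_trans le.
  have alp : al `^ (p - 1) * al = al `^ p by rewrite mulrC mulr_powRB1// ?ltW//; lra.
  have bep : be `^ (p - 1) * be = be `^ p by rewrite mulrC mulr_powRB1// ?ltW//; lra.
  have XAE : XA = a * al by rewrite mulrC divfK// gt_eqF.
  have XBE : XB = b * be by rewrite mulrC divfK// gt_eqF.
  have tB := tang B be (ltW be0); rewrite -/XB -/MB XBE bE in tB.
  have tA := tang A al (ltW al0); rewrite -/XA -/MA XAE aE in tA.
  (* Equality would make [x] constantly [al] on [A], and [XA] would be (a + 1) al instead of a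
     al. *)
  have {}tA : (a + 1) * al `^ p + p * al `^ (p - 1) * (a * al - (a + 1) * al) < MA.
    rewrite lt_neqAle tA andbT; apply/eqP => tE.
    have xal i : i \in A -> x i = al.
      move=> iA; apply/eqP/negPn/negP => xi.
      pose d j := x j `^ p - (al `^ p + p * al `^ (p - 1) * (x j - al)).
      have d0 j : j \in A -> 0 <= d j.
        by move=> _; rewrite subr_ge0 powR_tangent ?ltW.
      have ds : \sum_(j in A) d j = 0.
        rewrite sumrB big_split/= -big_distrr/= sumrB !sumr_const -/MA -/XA.
        by rewrite -[al `^ p *+ _]mulr_natl -[al *+ _]mulr_natl aE XAE tE subrr.
      have /eqP := psumr_eq0P d0 ds iA; rewrite subr_eq0 => /eqP E.
      by have := powR_tangent_lt p1 (ltW (xp i)) (ltW al0) xi; rewrite E ltxx.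
    have : XA = (a + 1) * al.
      by rewrite -aE mulr_natl -sumr_const; apply: eq_bigr.
    rewrite XAE mulrDl mul1r -[X in X = _]addr0 => /addrI/esym/eqP.
    by rewrite gt_eqF.
  have alb : al `^ p <= be `^ p by rewrite ge0_ler_powR ?nnegrE ?(ltW al0) ?(ltW be0)//; lra.
  have : p * al `^ (p - 1) * (a * al - (a + 1) * al) = - p * al `^ p.
    by rewrite -alp; ring.
  have : p * be `^ (p - 1) * (b * be - (b - 1) * be) = p * be `^ p.
    by rewrite -bep; ring.
  (* Added together, the tangent bounds exceed the new p-mass by (p - 1) (be^p - al^p), which is
     nonnegative. *)
  move=> E1 E2; rewrite E1 in tB; rewrite E2 in tA; nra.
set m := (XA + XB) / (a + b).
have abp : 0 < a + b by rewrite addr_gt0.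
have m0 : 0 < m by rewrite divr_gt0// ltr_wpDr.
have mE : a * m + b * m = XA + XB by rewrite -mulrDl mulrC divfK// gt_eqF.
exists m, m; split; rewrite ?(ltW m0)//; right; split.
  have lt : a * m < XA.
    move: gt; rewrite ltr_pdivrMr// mulrAC ltr_pdivlMr// => gt.
    rewrite -(ltr_pM2r abp) -mulrA divfK ?gt_eqF//; lra.
  have : b * m <= a * m by rewrite ler_pM2r.
  have -> : b * m = XA + XB - a * m by rewrite -mE; ring.
  nra.
have tB := tang B m (ltW m0); have tA := tang A m (ltW m0).
rewrite -/XA -/MA aE in tA; rewrite -/XB -/MB bE in tB.
(* Both tangents are taken at m and the total is unchanged, so the linear terms cancel. *)
have : p * m `^ (p - 1) * (XA - (a + 1) * m) + p * m `^ (p - 1) * (XB - (b - 1) * m) = 0.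
  by rewrite -mulrDr; apply/eqP; rewrite mulf_eq0; apply/orP; right; apply/eqP; lra.
lra.
Qed.

(** One vertex moves from class k to class l, and these two classes receive the weights of
    [rebalance]. The total sum is preserved, so by [qform_cgraph] only two block squares change, and
    either the form or the p-norm improves strictly while the other gets no worse. *)
Lemma move_vertex_improves (R : realType) (p : R) n r (c : {ffun 'I_n -> 'I_r})
    (x : 'I_n -> R) k l : 1 < p -> (forall i, 0 < x i) ->
  \sum_i x i `^ p = 1 -> pspectral_radius p (cgraph c) = qform (cgraph c) x ->
  0 < pspectral_radius p (cgraph c) ->
  (#|[set i | c i == l]|.+2 <= #|[set i | c i == k]|)%N ->
  exists c' : {ffun 'I_n -> 'I_r},
    pspectral_radius p (cgraph c) < pspectral_radius p (cgraph c').
Proof.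
move=> p1 xp xS xE lam0 kl; set A := [set i | c i == k] in kl; set B := [set i | c i == l] in kl.
have [al [be [al0 be0 SE alt]]] := rebalance p1 xp kl.
have [v vA] : exists v, v \in A by apply/set0Pn; rewrite -card_gt0; case: #|A| kl.
have n0 : (0 < n)%N by exact: leq_ltn_trans (ltn_ord v).
have lk : l != k.
  by apply: contraTneq kl => lk; rewrite /A /B lk -ltnNge ltnW.
have vk : c v = k by move: vA; rewrite inE => /eqP.
pose c' : {ffun 'I_n -> 'I_r} := [ffun i => if i == v then l else c i].
have c'A i : (c' i == k) = (i \in A :\ v).
  by rewrite ffunE !inE; case: (i =P v) => [->|_]//=; rewrite (negPf lk).
have c'B i : (c' i == l) = (i \in v |: B).
  by rewrite ffunE !inE; case: (i =P v) => [->|_]//=; rewrite eqxx.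
pose z i := if c' i == k then al else if c' i == l then be else x i.
have zA i : i \in A :\ v -> z i = al by rewrite -c'A /z => ->.
have zB i : i \in v |: B -> z i = be.
  by rewrite -c'B /z => /eqP->; rewrite (negPf lk) eqxx.
have z0 i : 0 <= z i by rewrite /z; case: ifP => // _; case: ifP => // _; exact: ltW.
have cA' : #|A :\ v| = #|A|.-1 by have := cardsD1 v A; rewrite vA => ->.
have cB' : #|v |: B| = #|B|.+1.
  by rewrite cardsU1 inE vk eq_sym (negPf lk).
have fib m : m != k -> m != l -> forall i, (c' i == m) = (c i == m).
  move=> mk ml i; rewrite ffunE; case: (i =P v) => // ->.
  by rewrite vk eq_sym (negPf ml) eq_sym (negPf mk).
have split (F : 'I_r -> R) : \sum_m F m = F k + F l + \sum_(m | (m != k) && (m != l)) F m.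
  by rewrite (bigD1 k)//= (bigD1 l)//= addrA.
have sumA (f : R -> R) : \sum_(i | c' i == k) f (z i) = #|A|.-1%:R * f al.
  rewrite (eq_bigl _ _ c'A) (eq_bigr (fun=> f al)) => [|i iA]; last by rewrite zA.
  by rewrite sumr_const cA' mulr_natl.
have sumB (f : R -> R) : \sum_(i | c' i == l) f (z i) = #|B|.+1%:R * f be.
  rewrite (eq_bigl _ _ c'B) (eq_bigr (fun=> f be)) => [|i iB]; last by rewrite zB.
  by rewrite sumr_const cB' mulr_natl.
have sumO (f : R -> R) m : (m != k) && (m != l) ->
    \sum_(i | c' i == m) f (z i) = \sum_(i | c i == m) f (x i).
  move=> /andP[mk ml]; apply: eq_big => [i|i /eqP im]; first exact: fib.
  by rewrite /z im (negPf mk) (negPf ml).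
have sumx (f : R -> R) : \sum_i f (x i) = \sum_(i in A) f (x i) +
    \sum_(i in B) f (x i) + \sum_(m | (m != k) && (m != l)) \sum_(i | c i == m) f (x i).
  rewrite (partition_big c xpredT)//= split; congr (_ + _ + _).
    by apply: eq_bigl => i; rewrite inE.
  by apply: eq_bigl => i; rewrite inE.
have sumz (f : R -> R) : \sum_i f (z i) = #|A|.-1%:R * f al +
    #|B|.+1%:R * f be + \sum_(m | (m != k) && (m != l)) \sum_(i | c i == m) f (x i).
  rewrite (partition_big c' xpredT)//= split sumA sumB; congr (_ + _).
  by apply: eq_bigr => m; exact: sumO.
exists c'; have := spectral_ub (cgraph c') p1 n0 z0.
set lam' := pspectral_radius p (cgraph c').
set M' := \sum_i z i `^ p => ub.
have M'E := sumz (fun t => t `^ p); rewrite -/M' in M'E.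
have ME := sumx (fun t => t `^ p); rewrite xS in ME.
have QE : qform (cgraph c') z = qform (cgraph c) x +
   ((\sum_(i in A) x i) ^+ 2 + (\sum_(i in B) x i) ^+ 2) -
   ((#|A|.-1%:R * al) ^+ 2 + (#|B|.+1%:R * be) ^+ 2).
  rewrite !qform_cgraph (sumz id) (sumx id) SE !split (sumA id) (sumB id).
  rewrite [X in _ - (_ + X)](eq_bigr (fun m => (\sum_(i | c i == m) x i) ^+ 2)); last first.
    by move=> m mkl; rewrite (sumO id m mkl).
  have -> : \sum_(i in A) x i = \sum_(i | c i == k) x i.
    by apply: eq_bigl => i; rewrite inE.
  have -> : \sum_(i in B) x i = \sum_(i | c i == l) x i.
    by apply: eq_bigl => i; rewrite inE.
  by ring.
rewrite QE -xE in ub; set lam := pspectral_radius p (cgraph c) in lam0 ub *.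
have p0 : 0 < 2 / p by rewrite divr_gt0//; lra.
have M'0 : 0 <= M' by apply: sumr_ge0 => i _; exact: powR_ge0.
have lam'0 : 0 <= lam' by exact: spectral_ge0.
have [[le lt]|[lt le]] := alt.
  have M1 : M' `^ (2 / p) < 1.
    by rewrite -[ltRHS](congr1 (@^~ (2 / p)) (powR1 R)) gt0_ltr_powR ?nnegrE//; lra.
  have := powR_ge0 M' (2 / p); nra.
have M1 : M' `^ (2 / p) <= 1.
  rewrite -[leRHS](congr1 (@^~ (2 / p)) (powR1 R)).
  by rewrite ge0_ler_powR ?nnegrE ?(ltW p0)//; lra.
nra.
Qed.

(** Through the eigenequation a zero entry forces zeros on all other classes; inside one class there
    are no edges, so the form would vanish. *)
Lemma cgraph_spectral_pos (R : realType) (p : R) n r (c : {ffun 'I_n -> 'I_r})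
    (x : 'I_n -> R) : 1 < p -> (forall i, 0 <= x i) ->
  \sum_i x i `^ p = 1 -> pspectral_radius p (cgraph c) = qform (cgraph c) x ->
  0 < pspectral_radius p (cgraph c) -> forall v, 0 < x v.
Proof.
move=> p1 x0 xS xE lam0 v; rewrite lt_neqAle x0 andbT eq_sym; apply/negP => /eqP xv.
have := eigenequation v p1 x0 xS xE.
rewrite xv powR0 ?mulr0 ?subr_eq0 ?gt_eqF// => D0.
have nb0 j : c v != c j -> x j = 0 by exact: (psumr_eq0P (fun i _ => x0 i) D0).
suff q0 : qform (cgraph c) x = 0 by move: lam0; rewrite xE q0 ltxx.
rewrite /qform big1// => i _; have [ci|ci] := eqVneq (c v) (c i).
  by rewrite /wdeg big1 ?mulr0// => j /= cj; apply: nb0; rewrite ci.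
by rewrite nb0// mul0r.
Qed.

Lemma spectral_gt0 (R : realType) (p : R) n (G : sgraph n) i j : 1 < p ->
  G i j -> 0 < pspectral_radius p G.
Proof.
move=> p1 Gij; have n0 : (0 < n)%N by exact: leq_ltn_trans (ltn_ord i).
have := spectral_ub G p1 n0 (fun=> ler01).
rewrite lt_neqAle spectral_ge0// andbT; apply: contraTN => /eqP <-.
rewrite mul0r -ltNge /qform (bigD1 i)//= ltr_pwDl ?sumr_ge0//.
  rewrite mul1r /wdeg (bigD1 j)//= ltr_pwDl// sumr_ge0//.
by move=> k _; rewrite mul1r wdeg_ge0.
Qed.

(** The values for T_r(n), [G] and the majorizing r-partite graph form a closed chain of
    inequalities, hence are equal; the equality case of [degree_majorization] then identifies
    [G]. *)
Lemma spectral_turan (R : realType) (p : R) n (G : sgraph n) r :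
  1 < p -> (2 <= r)%N -> (forall K, ~~ is_clique G r.+1 K) ->
  pspectral_radius p (turan r n) <= pspectral_radius p G ->
  graph_iso G (turan r n).
Proof.
move=> p1 r2 clG hG; have r0 : (0 < r)%N by exact: ltnW.
(* With at most one vertex there is no edge, whereas the argument below needs a positive spectral
   radius. *)
have [n1|n2] := leqP n 1.
  exists 1%g => i j; have -> : j = i.
    by apply: val_inj => /=; move: (ltn_ord i) (ltn_ord j); case: (i : nat) (j : nat) n1; lia.
  by rewrite !adj_irr.
have n0 : (0 < n)%N by exact: ltnW.
pose c0 := [ffun i : 'I_n => Ordinal (ltn_pmod i r0)].
pose lam (c : {ffun 'I_n -> 'I_r}) := pspectral_radius p (cgraph c).
have turanE : pspectral_radius p (turan r n) = lam c0.
  apply/eqP; rewrite eq_le; apply/andP; split; apply: spectral_iso => //.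
    exact: cgraph_turan.
  by apply/graph_iso_sym; exact: cgraph_turan.
have lam0 : 0 < lam c0.
  rewrite -turanE; apply: (@spectral_gt0 R p n _ (Ordinal n0) (Ordinal n2)) => //=.
  by rewrite mod0n modn_small.
have maxT c : (forall c', lam c' <= lam c) -> graph_iso (cgraph c) (turan r n).
  move=> cmax; apply: balanced_turan => // k l; rewrite leqNgt; apply/negP => kl.
  have [x [x0 xS xE]] := spectral_pair (cgraph c) p1 n0.
  have lc : 0 < pspectral_radius p (cgraph c) by exact: lt_le_trans lam0 (cmax c0).
  have xp := cgraph_spectral_pos p1 x0 xS xE lc.
  have [|c'] := @move_vertex_improves R p n r c x k l p1 xp xS xE lc.
    by rewrite !cardsE.
  by rewrite ltNge; have := cmax c'; rewrite /lam => ->.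
have lam_max c : lam c <= lam c0.
  have [cm _ cmax] := @Order.TotalTheory.arg_maxP _ _ _ c0 xpredT lam isT.
  have {}cmax c' : lam c' <= lam cm by exact: cmax.
  apply: le_trans (cmax c) _; rewrite -turanE; apply: spectral_iso => //.
  exact: maxT.
have [x [x0 xS xE]] := spectral_pair G p1 n0.
have [|c [cr cD ceq]] := @degree_majorization R n G x r [set: 'I_n] x0.
  by move=> K _; exact: clG.
pose cc := [ffun i : 'I_n => Ordinal (cr i (in_setT i))].
have ccE i j : (cc i != cc j) = (c i != c j) by rewrite !ffunE.
have wG i : \sum_(j in [set: 'I_n] | G i j) x j = wdeg G x i.
  by apply: eq_bigl => j; rewrite inE.
have wC i : \sum_(j in [set: 'I_n] | c i != c j) x j = wdeg (cgraph cc) x i.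
  by apply: eq_bigl => j; rewrite inE/= ccE.
have {}cD i : wdeg G x i <= wdeg (cgraph cc) x i.
  by rewrite -wG -wC; exact: cD.
have le1 : qform G x <= qform (cgraph cc) x.
  by apply: ler_sum => i _; rewrite ler_wpM2l.
have le2 : qform (cgraph cc) x <= lam cc.
  by have := spectral_ub (cgraph cc) p1 n0 x0; rewrite xS powR1 mulr1.
have le3 := lam_max cc; rewrite turanE xE in hG.
have ccE' : pspectral_radius p (cgraph cc) = qform (cgraph cc) x.
  by apply/eqP; rewrite eq_le le2 andbT; apply: le_trans le3 (le_trans hG le1).
have lcc : 0 < pspectral_radius p (cgraph cc).
  by rewrite ccE'; apply: lt_le_trans lam0 (le_trans hG le1).
have xp := cgraph_spectral_pos p1 x0 xS ccE' lcc.
have qE : \sum_i (x i * (wdeg (cgraph cc) x i - wdeg G x i)) = 0.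
  under eq_bigr do rewrite mulrBr.
  rewrite sumrB -/(qform G x) -/(qform _ x); apply/eqP; rewrite subr_eq0 eq_le le1 andbT.
  exact: le_trans le2 (le_trans le3 hG).
have eqw i : wdeg G x i = wdeg (cgraph cc) x i.
  have q0 j : true -> 0 <= x j * (wdeg (cgraph cc) x j - wdeg G x j).
    by move=> _; rewrite mulr_ge0 ?subr_ge0.
  have /eqP := psumr_eq0P q0 qE (i := i) isT.
  by rewrite mulf_eq0 gt_eqF//= subr_eq0 => /eqP.
have GE i j : G i j = cgraph cc i j.
  rewrite /= ccE; apply: ceq; rewrite ?inE// => k _.
  by rewrite wG wC.
have [s sE] : graph_iso (cgraph cc) (turan r n).
  apply: maxT => c'; apply: le_trans (lam_max c') _.
  exact: le_trans hG (le_trans le1 le2).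
by exists s => i j; rewrite GE.
Qed.

(** * Spectral radius and density *)

Lemma clique_weight2 (R : realType) n (G : sgraph n) (y : 'I_n -> R) :
  2 * clique_weight G y 2 = qform G y.
Proof.
have := clique_weight_succ G y 1 => <-.
transitivity (\sum_(K | is_clique G 1 K) \sum_(w in K) y w * wdeg G y w).
  apply: eq_bigr => K /is_cliqueP[/eqP/cards1P[v ->] _].
  rewrite !big_set1; congr (_ * _); apply: eq_bigl => j; rewrite inE.
  apply/forall_inP/idP => [|Gvj w]; first by apply; rewrite inE.
  by rewrite inE => /eqP->.
rewrite (sum_clique_face G 0 (fun _ w => y w * wdeg G y w)).
rewrite (big_pred1 set0) => [|M].
  apply: eq_bigl => i; rewrite inE.
  by apply/forall_inP => v; rewrite inE.
apply/is_cliqueP/eqP => [[/eqP]|->]; first by rewrite cards_eq0 => /eqP.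
by rewrite cards0; split=> // i j; rewrite inE.
Qed.

(** The test vector is all ones. The part sizes deviate from n/r by at most 1, and the deviations
    [d k] sum to 0, so the squares of the sizes add up to at most n^2/r + r. *)
Lemma turan_spectral_ge (R : realType) (p : R) r n : 1 < p -> (0 < r)%N -> (0 < n)%N ->
  (1 - r%:R^-1 - r%:R / n%:R ^+ 2) * n%:R `^ (2 - 2 / p) <=
  pspectral_radius p (turan r n).
Proof.
move=> p1 r0 n0; pose c0 := [ffun i : 'I_n => Ordinal (ltn_pmod i r0)].
apply: le_trans (spectral_iso p1 n0 (graph_iso_sym (cgraph_turan n r0))).
have N0 : 0 < n%:R :> R by rewrite ltr0n.
have R0 : 0 < r%:R :> R by rewrite ltr0n.
have := spectral_ub (cgraph c0) p1 n0 (fun=> ler01); rewrite -/c0 powR1 sumr_const card_ord.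
rewrite -ler_pdivrMr ?powR_gt0//; apply: le_trans.
rewrite powRB ?(gt_eqF N0) ?implybT// mulrA ler_pM2r ?invr_gt0 ?powR_gt0//.
rewrite qform_cgraph sumr_const card_ord powR_mulrn//.
pose d k : R := (\sum_(i | c0 i == k) 1) - n%:R / r%:R.
have dS : \sum_k d k = 0.
  have -> : \sum_k d k = \sum_k \sum_(i | c0 i == k) 1 - \sum_(k < r) (n%:R / r%:R).
    by rewrite sumrB.
  have <- : \sum_(i < n) (1 : R) = \sum_k \sum_(i | c0 i == k) 1.
    by rewrite (partition_big c0 xpredT).
  rewrite !sumr_const !card_ord.
  by rewrite -[_ *+ r]mulr_natr divfK ?subrr// gt_eqF.
have d1 k : d k ^+ 2 <= 1.
  rewrite /d sumr_const.
  rewrite (_ : #|_| = #|[pred i : 'I_n | (i %% r == k)%N]|); last first.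
    by apply: eq_card => i; rewrite unfold_in [RHS]inE /c0 ffunE.
  rewrite turan_part_size//; set z := _ - _.
  suff /andP[z1 z2] : -1 <= z <= 1 by nra.
  rewrite /z.
  have : n%:R = (n %/ r)%:R * r%:R + (n %% r)%:R :> R by rewrite -natrM -natrD -divn_eq.
  have m0 : 0 <= (n %% r)%:R :> R by [].
  have : (n %% r)%:R <= r%:R :> R by rewrite ler_nat ltnW// ltn_pmod.
  move=> mr nE.
  have -> : n%:R / r%:R = (n %/ r)%:R + (n %% r)%:R / r%:R :> R.
    by rewrite nE mulrDl mulfK// gt_eqF.
  have : 0 <= (n %% r)%:R / r%:R :> R by exact: divr_ge0.
  have : (n %% r)%:R / r%:R <= 1 :> R by rewrite ler_pdivrMr// mul1r.
  by case: (k < n %% r)%N; rewrite natrD /=; move=> *; apply/andP; split; lra.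
have -> : \sum_k (\sum_(i | c0 i == k) 1) ^+ 2 = \sum_k d k ^+ 2 + n%:R ^+ 2 / r%:R.
  rewrite (eq_bigr (fun k => d k ^+ 2 + 2 * (n%:R / r%:R) * d k + (n%:R / r%:R) ^+ 2)).
    rewrite !big_split/= -big_distrr/= dS mulr0 addr0 sumr_const card_ord.
    rewrite -[_ *+ r]mulr_natr; congr (_ + _); field; exact: lt0r_neq0.
  by move=> k _; rewrite /d; ring.
have : \sum_k d k ^+ 2 <= r%:R.
  rewrite -[X in _ <= X%:R](card_ord r) -sum1_card natr_sum.
  by apply: ler_sum => k _; exact: d1.
have -> : (1 - r%:R^-1 - r%:R / n%:R ^+ 2) * n%:R ^+ 2 = n%:R ^+ 2 - n%:R ^+ 2 / r%:R - r%:R :> R.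
  by field; rewrite !lt0r_neq0.
lra.
Qed.

(* Hoelder's inequality over the ordered edges. *)
Lemma spectral_le_density (R : realType) (p : R) n (G : sgraph n) (x : 'I_n -> R) g :
  1 < p -> (0 < n)%N -> 0 < g -> (forall i, 0 <= x i) ->
  pspectral_radius p G = qform G x ->
  qform G (fun=> 1 : R) <= g * n%:R ^+ 2 -> qform G (fun i => x i `^ p) <= g ->
  pspectral_radius p G <= g * n%:R `^ (2 - 2 / p).
Proof.
move=> p1 n0 g0 x0 xE N_le y_le; have p0 : 0 < p by lra.
have N0 : 0 < n%:R :> R by rewrite ltr0n.
have pairE (f : 'I_n -> R) : qform G f = \sum_(e : 'I_n * 'I_n | G e.1 e.2) f e.1 * f e.2.
  rewrite -(pair_big_dep xpredT (fun i j => G i j) (fun i j => f i * f j))/=.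
  by apply: eq_bigr => i _; rewrite /wdeg big_distrr.
have lam0 : 0 <= pspectral_radius p G by exact: spectral_ge0.
have rhs0 : 0 <= g * n%:R `^ (2 - 2 / p) by rewrite mulr_ge0 ?powR_ge0 ?(ltW g0).
suff : pspectral_radius p G `^ p <= (g * n%:R `^ (2 - 2 / p)) `^ p.
  apply: contraTT; rewrite -!ltNge => lt.
  by rewrite gt0_ltr_powR ?nnegrE.
rewrite xE pairE.
have := @powR_sum_le R p _ (fun e : 'I_n * 'I_n => G e.1 e.2) (fun e => x e.1 * x e.2) p1.
move=> /(_ (fun e => mulr_ge0 (x0 _) (x0 _)))/le_trans; apply.
have -> : #|[pred e : 'I_n * 'I_n | G e.1 e.2]|%:R = qform G (fun=> 1 : R).
  rewrite pairE -sum1_card natr_sum; apply: eq_big => [e|e _]; first by rewrite inE.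
  by rewrite mulr1.
rewrite (eq_bigr (fun e => x e.1 `^ p * x e.2 `^ p)) => [|e _]; last by rewrite powRM.
rewrite -(pairE (fun i => x i `^ p)).
have q1 : 0 <= qform G (fun=> 1 : R) by exact: qform_ge0.
have q2 : 0 <= qform G (fun i => x i `^ p) by apply: qform_ge0 => i; exact: powR_ge0.
apply: (le_trans (y := (g * n%:R ^+ 2) `^ (p - 1) * g)).
  apply: ler_pM => //; first exact: powR_ge0.
  by apply: ge0_ler_powR; rewrite ?nnegrE ?mulr_ge0 ?sqr_ge0 ?(ltW g0)//; lra.
rewrite powRM ?sqr_ge0 ?(ltW g0)// [leRHS]powRM ?powR_ge0 ?(ltW g0)// mulrAC [_ `^ (p - 1) * g]mulrC.
rewrite (mulr_powRB1 (ltW g0) p0) -(powR_mulrn 2 (ltW N0)) -!powRrM.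
rewrite le_eqVlt; apply/orP; left; apply/eqP; congr (_ * _ `^ _).
by field; rewrite gt_eqF.
Qed.

(** In the eigenequation the weighted degree is at most the sum of all entries, hence at most
    n^((p-1)/p) by the power-mean inequality. *)
Lemma eigenvector_le (R : realType) (p g : R) n (G : sgraph n) (x : 'I_n -> R) i :
  1 < p -> 0 < g -> (forall i, 0 <= x i) -> \sum_i x i `^ p = 1 ->
  pspectral_radius p G = qform G x -> g * n%:R `^ (2 - 2 / p) <= pspectral_radius p G ->
  x i `^ p <= g^-1 `^ (p / (p - 1)) / n%:R.
Proof.
move=> p1 g0 x0 xS xE lam_ge; have p0 : 0 < p by lra.
have n0 : (0 < n)%N by exact: leq_ltn_trans (ltn_ord i).
have N0 : 0 < n%:R :> R by rewrite ltr0n.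
have pm : 0 < p - 1 by lra.
have wle : wdeg G x i <= n%:R `^ ((p - 1) / p).
  apply: (le_trans (y := \sum_j x j)).
    by rewrite [leRHS](bigID (G i))/= lerDl sumr_ge0.
  have S0 : 0 <= \sum_j x j by exact: sumr_ge0.
  have := @powR_sum_le R p _ xpredT x p1 x0; rewrite xS mulr1.
  rewrite (_ : #|_| = n); last by rewrite -[RHS]card_ord; apply: eq_card.
  move=> /(ge0_ler_powR (r := p^-1)); rewrite !nnegrE !powR_ge0 -!powRrM.
  rewrite mulfV ?gt_eqF// powRr1//; apply => //.
  by rewrite invr_ge0 ltW.
rewrite (eigenequation i p1 x0 xS xE) in wle.
have nq : 0 < n%:R `^ (2 - 2 / p) :> R by exact: powR_gt0.
have xle : x i `^ (p - 1) <= g^-1 * n%:R `^ (- ((p - 1) / p)).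
  rewrite -(ler_pM2l (mulr_gt0 g0 nq)).
  have -> : g * n%:R `^ (2 - 2 / p) * (g^-1 * n%:R `^ (- ((p - 1) / p))) =
      n%:R `^ ((p - 1) / p).
    rewrite mulrACA mulfV ?gt_eqF// mul1r -powRD ?(gt_eqF N0) ?implybT//.
    by congr (_ `^ _); field; rewrite gt_eqF.
  apply: le_trans wle; rewrite ler_wpM2r ?powR_ge0//.
have : (x i `^ (p - 1)) `^ (p / (p - 1)) <=
    (g^-1 * n%:R `^ (- ((p - 1) / p))) `^ (p / (p - 1)).
  apply: ge0_ler_powR xle; rewrite ?nnegrE ?powR_ge0//.
    by rewrite divr_ge0 ?(ltW p0) ?(ltW pm).
  by rewrite mulr_ge0 ?powR_ge0 ?invr_ge0 ?(ltW g0).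
rewrite -powRrM mulrCA mulfV ?gt_eqF// mulr1 powRM ?powR_ge0 ?invr_ge0 ?(ltW g0)//.
rewrite -powRrM.
have -> : - ((p - 1) / p) * (p / (p - 1)) = -1 by field; rewrite !gt_eqF.
by rewrite powR_inv1 ?(ltW N0).
Qed.

(** The ratios of [clique_weight_ratio] are multiplied: the first r - 1 are at least e/r = e^2, and
    in the last one only the coefficient r th survives. *)
Lemma clique_weight_ge (R : realFieldType) n (G : sgraph n) (y : 'I_n -> R) r (th : R) :
  (2 <= r)%N -> (forall i, 0 <= y i) -> weight y [set: 'I_n] = 1 -> 0 < th ->
  1 - r%:R^-1 + th <= 2 * clique_weight G y 2 ->
  th * r%:R^-1 ^+ (2 * r).-1 <= clique_weight G y r.+1.
Proof.
move=> r2 y0 y1 th0 k2; have r0 : (0 < r)%N by exact: ltnW.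
have ratio := clique_weight_ratio y0 y1 th0 r0 k2.
set k := clique_weight G y in ratio *; set e := r%:R^-1 : R in ratio *.
have R0 : 0 < r%:R :> R by rewrite ltr0n.
have re : r%:R * e = 1 by rewrite mulfV// gt_eqF.
have e0 : 0 < e by rewrite invr_gt0.
have e2 : 2 * e <= 1 by rewrite -[leRHS]re ler_pM2r ?ler_nat.
have low s : (s < r)%N -> e ^+ (2 * s) <= k s.+1.
  elim: s => [_|s IH sr]; first by rewrite /k clique_weight1 y1.
  have {IH}IH := IH (ltnW sr); have [k0 le] := ratio s (ltnW sr).
  have A : e <= 1 - s.+1%:R * e + s.+1%:R * th.
    apply: (le_trans (y := 1 - s.+1%:R * e)); last by rewrite lerDl mulr_ge0// ltW.
    have : s.+2%:R * e <= r%:R * e by rewrite ler_pM2r// ler_nat.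
    by rewrite re -[s.+2]addn1 natrD; lra.
  have {}le : e * k s.+1 <= s.+2%:R * k s.+2.
    by apply: le_trans le; rewrite ler_pM2r.
  have k1 : 0 <= k s.+2 by exact: clique_weight_ge0.
  have {}le : e * k s.+1 <= r%:R * k s.+2.
    by apply: le_trans le _; rewrite ler_wpM2r// ler_nat.
  rewrite mulnS exprD expr2 -mulrA; apply: (le_trans (y := e * (e * k s.+1))).
    by rewrite ler_pM2l// ler_pM2l.
  have := ler_wpM2l (ltW e0) le; rewrite [e * (r%:R * _)]mulrA.
  by rewrite [e * r%:R]mulrC re mul1r.
case: r r2 r0 @e ratio R0 re e0 e2 low k2 => [//|r] r2 r0 e ratio R0 re e0 e2 low k2.
have [k0 le] := ratio r (ltnSn r).
have lowr := low r (ltnSn r).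
have -> : (2 * r.+1).-1 = (2 * r).+1 by rewrite mulnS.
have : (1 - r.+1%:R * e + r.+1%:R * th) * k r.+1 = r.+1%:R * (th * k r.+1).
  by rewrite re; ring.
move=> E; rewrite E in le.
have k1 : 0 <= k r.+2 by exact: clique_weight_ge0.
(* Here r + 2 <= 2 (r + 1), and the 2 is paid for by one more factor e <= 1/2; hence the odd
   exponent. *)
have {}le : r.+1%:R * (th * k r.+1) <= r.+1%:R * (2 * k r.+2).
  apply: le_trans le _; rewrite mulrA ler_wpM2r// -natrM ler_nat; lia.
rewrite ler_pM2l// in le; rewrite exprS mulrCA.
have : th * e ^+ (2 * r) <= 2 * k r.+2 by apply: le_trans le; rewrite ler_pM2l.
move=> /(ler_wpM2l (ltW e0)) h; apply: le_trans h _.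
by rewrite mulrA -[leRHS]mul1r ler_wpM2r// mulrC.
Qed.

(** By [spectral_le_density] one of two distributions, uniform or x_i^p, has edge density above 1 -
    1/r + th. The entries of both are at most r^(p/(p-1)) / n, so a large clique weight puts many
    cliques on some edge. *)
Lemma js_of_spectral (R : realType) (p : R) n (G : sgraph n) r (th : R) :
  1 < p -> (2 <= r)%N -> (0 < n)%N -> 0 < th ->
  (1 - r%:R^-1 + th) * n%:R `^ (2 - 2 / p) < pspectral_radius p G ->
  (exists K, is_clique G r.+1 K) /\
  th * r%:R^-1 ^+ (2 * r).-1 * (r%:R `^ (p / (p - 1)))^-1 ^+ r.+1 * n%:R ^+ r.-1 <=
    (js G r.+1)%:R.
Proof.
move=> p1 r2 n0 th0 lam_gt; set X := r%:R `^ _.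
set e := r%:R^-1 : R in lam_gt *.
have N0 : 0 < n%:R :> R by rewrite ltr0n.
have R0 : 0 < r%:R :> R by rewrite ltr0n ltnW.
have re : r%:R * e = 1 by rewrite mulfV// gt_eqF.
have e0 : 0 < e by rewrite invr_gt0.
have e2 : 2 * e <= 1 by rewrite -[leRHS]re ler_pM2r ?ler_nat.
have X0 : 0 < X by exact: powR_gt0.
have X1 : 1 <= X.
  rewrite -[leLHS](powRr0 (r%:R : R)) ler_powR ?ler1n ?(ltnW r2)//.
  by rewrite divr_ge0//; lra.
have [x [x0 xS xE]] := spectral_pair G p1 n0.
have [y [y0 yB yS y2]] : exists y : 'I_n -> R, [/\ forall i, 0 <= y i,
    forall i, y i <= X / n%:R, weight y [set: 'I_n] = 1 &
    1 - e + th <= 2 * clique_weight G y 2].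
  have sumT (f : 'I_n -> R) : weight f [set: 'I_n] = \sum_i f i.
    by apply: eq_bigl => i; rewrite inE.
  have [lt|le1] := ltrP ((1 - e + th) * n%:R ^+ 2) (qform G (fun=> 1 : R)).
    exists (fun=> n%:R^-1 * 1); split=> [i|i||].
    - by rewrite mulr1 invr_ge0.
    - by rewrite mulr1 -[leLHS]mul1r ler_wpM2r ?invr_ge0.
    - rewrite sumT mulr1 sumr_const card_ord -[_ *+ n]mulr_natr mulVf//.
      by rewrite gt_eqF.
    - rewrite clique_weight2 qformZ exprVn mulrC ler_pdivlMr ?exprn_gt0//.
      exact: ltW.
  have [lt|le2] := ltrP (1 - e + th) (qform G (fun i => x i `^ p)).
    exists (fun i => x i `^ p); split=> [i|i||].
    - exact: powR_ge0.
    - have -> : X = e^-1 `^ (p / (p - 1)) by rewrite invrK.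
      apply: (@eigenvector_le R p e n G x i) => //.
      apply: le_trans (ltW lam_gt); rewrite ler_pM2r ?powR_gt0//; lra.
    - by rewrite sumT.
    - by rewrite clique_weight2 ltW.
  have g0 : 0 < 1 - e + th by lra.
  have := spectral_le_density p1 n0 g0 x0 xE le1 le2.
  by rewrite leNgt lam_gt.
have kge := clique_weight_ge r2 y0 yS th0 y2; split.
  apply: contrapT => noK; move: kge; rewrite /clique_weight big_pred0 => [|K].
    by rewrite leNgt mulr_gt0// exprn_gt0.
  by apply/negP => cK; apply: noK; exists K.
have yB' i : 0 <= y i <= X / n%:R by rewrite y0 yB.
have r3 : (2 <= r.+1)%N by rewrite ltnS ltnW.
have c0 : 0 < X^-1 ^+ r.+1 * n%:R ^+ r.-1 :> R.
  by rewrite mulr_gt0 ?exprn_gt0 ?invr_gt0.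
have h := ler_wpM2r (ltW c0) (le_trans kge (clique_weight_le_js G r3 yB')).
rewrite -mulrA; apply: le_trans h _.
rewrite le_eqVlt; apply/orP; left; apply/eqP.
clear -r2 X0 N0; clearbody X; case: r r2 => [//|r] _.
rewrite /= exprMn !exprVn !exprSr; field.
by rewrite !lt0r_neq0 ?exprn_gt0.
Qed.

(** * Deleting vertices *)

Lemma del_sym n (G : sgraph n.+1) (u : 'I_n.+1) :
  symmetric (fun i j => G (lift u i) (lift u j)).
Proof. by move=> i j; rewrite adj_sym. Qed.

Lemma del_irr n (G : sgraph n.+1) (u : 'I_n.+1) :
  irreflexive (fun i j => G (lift u i) (lift u j)).
Proof. by move=> i; rewrite adj_irr. Qed.

Definition del n (G : sgraph n.+1) (u : 'I_n.+1) : sgraph n :=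
  SGraph (del_sym G u) (del_irr G u).

Lemma js_del n (G : sgraph n.+1) u s : (js (del G u) s <= js G s)%N.
Proof. by apply: js_induced (@lift_inj _ u) _. Qed.

(* Hoelder at the low-degree vertex [v] shows that the smallest entry of the
   eigenvector is well below the average; the vertex [u] carrying that entry,
   not [v], is the one to delete. *)
Lemma min_entry_small (R : realType) (p g eta : R) n (G : sgraph n) (x : 'I_n -> R) v :
  1 < p -> 0 <= g -> 0 <= eta <= 1 -> (forall i, 0 <= x i) ->
  \sum_i x i `^ p = 1 -> pspectral_radius p G = qform G x ->
  g * n%:R `^ (2 - 2 / p) <= pspectral_radius p G ->
  #|[set w | G v w]|%:R < (g * (1 - eta) - eta) * n%:R ->
  exists u, x u `^ p < (1 - eta) / n%:R.
Proof.
move=> p1 g0 /andP[eta0 eta1] x0 xS xE lam_ge deg; have p0 : 0 < p by lra.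
have pm : 0 < p - 1 by lra.
have n0 : (0 < n)%N by exact: leq_ltn_trans (ltn_ord v).
have N0 : 0 < n%:R :> R by rewrite ltr0n.
apply: contrapT => noU.
have big i : (1 - eta) / n%:R <= x i `^ p.
  by rewrite leNgt; apply/negP => lt; apply: noU; exists i.
set d := #|[set w | G v w]| in deg.
(* [s] bounds the p-mass of the neighbourhood of [v], since every other vertex carries at least (1 -
   eta)/n. *)
pose s := d%:R / n%:R + eta.
have dn : d%:R <= n%:R :> R by rewrite ler_nat -[leqRHS]card_ord max_card.
have dn1 : d%:R / n%:R <= 1 :> R by rewrite ler_pdivrMr// mul1r.
have dn0 : 0 <= d%:R / n%:R :> R by exact: divr_ge0.
have s0 : 0 <= s by rewrite addr_ge0.
have mass : \sum_(j | G v j) x j `^ p <= s.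
  have : (n%:R - d%:R) * ((1 - eta) / n%:R) <= \sum_(j | ~~ G v j) x j `^ p.
    have -> : n%:R - d%:R = #|[pred j | ~~ G v j]|%:R :> R.
      rewrite -[n in n%:R](card_ord n) -(cardC [pred j | G v j]) natrD.
      have -> : #|[pred j | G v j]| = d by apply: eq_card => j; rewrite !inE.
      by rewrite addrAC subrr add0r; congr (_%:R); apply: eq_card => j; rewrite !inE.
    by rewrite mulr_natl -sumr_const; apply: ler_sum => j _; exact: big.
  have : (n%:R - d%:R) * ((1 - eta) / n%:R) = (1 - d%:R / n%:R) * (1 - eta).
    by field; rewrite gt_eqF.
  have := xS; rewrite (bigID (G v))/= => xS' -> h.
  have : 0 <= eta * (d%:R / n%:R) by exact: mulr_ge0.
  by rewrite /s; lra.
have hold : wdeg G x v `^ p <= n%:R `^ (p - 1) * s `^ p.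
  apply: le_trans (powR_sum_le _ p1 x0) _.
  have -> : #|[pred j | G v j]| = d by apply: eq_card => j; rewrite !inE.
  (* The degree d is replaced by the larger n s so that s^p appears. *)
  apply: (le_trans (y := (n%:R * s) `^ (p - 1) * s)).
    apply: ler_pM => //; first by apply: sumr_ge0 => j _; exact: powR_ge0.
    apply: ge0_ler_powR; rewrite ?nnegrE ?mulr_ge0 ?(ltW pm)//.
    by rewrite /s mulrDr mulrCA mulfV ?gt_eqF// mulr1 lerDl mulr_ge0.
  by rewrite powRM// -mulrA [_ * s]mulrC mulr_powRB1.
have key : (g * (1 - eta)) `^ p <= s `^ p.
  rewrite -(ler_pM2l (powR_gt0 (p - 1) N0)); apply: le_trans hold.
  rewrite (eigenequation v p1 x0 xS xE) [leRHS]powRM ?powR_ge0 ?spectral_ge0//.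
  rewrite powRAC [(g * _) `^ _]powRM ?subr_ge0// mulrCA.
  have le1 : g `^ p * n%:R `^ (2 * (p - 1)) <= pspectral_radius p G `^ p.
    have -> : g `^ p * n%:R `^ (2 * (p - 1)) = (g * n%:R `^ (2 - 2 / p)) `^ p.
      rewrite powRM ?powR_ge0// -powRrM; congr (_ * _ `^ _).
      by field; rewrite gt_eqF.
    apply: ge0_ler_powR; rewrite ?nnegrE ?mulr_ge0 ?powR_ge0 ?(ltW p0)//.
    exact: spectral_ge0.
  have le2 : ((1 - eta) / n%:R) `^ (p - 1) <= (x v `^ p) `^ (p - 1).
    by apply: ge0_ler_powR; rewrite ?(ltW pm) ?nnegrE ?powR_ge0 ?divr_ge0 ?subr_ge0.
  apply: le_trans (ler_pM _ _ le1 le2); rewrite ?mulr_ge0 ?powR_ge0//.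
  rewrite -mulrA ler_wpM2l ?powR_ge0//.
  have -> : n%:R `^ (2 * (p - 1)) * ((1 - eta) / n%:R) `^ (p - 1) =
      n%:R `^ (p - 1) * (1 - eta) `^ (p - 1).
    rewrite powRM ?subr_ge0 ?invr_ge0// -(powR_inv1 (ltW N0)) -powRrM mulrCA.
    rewrite -powRD ?(gt_eqF N0) ?implybT// mulrC; congr (_ `^ _ * _); ring.
  rewrite ler_wpM2l ?powR_ge0//.
  rewrite -(mulr_powRB1 _ p0) ?subr_ge0//.
  by rewrite -[leRHS]mul1r ler_wpM2r ?powR_ge0//; lra.
have : g * (1 - eta) <= s.
  rewrite leNgt; apply/negP => lt; move: key; rewrite leNgt gt0_ltr_powR//.
  by rewrite nnegrE mulr_ge0// subr_ge0.
by rewrite /s leNgt -ltrBrDr ltr_pdivrMr// deg.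
Qed.

(** Follows from ln(1 + z) >= z/(1 + z) >= z/2, where the first inequality is ln(1 + w) <= w at w =
    -z/(1 + z). It is applied to q = 2 - 2/p, which may be below 1. *)
Lemma powR1D_ge (R : realType) (q z : R) : 0 <= q -> 0 <= z <= 1 ->
  1 + q * z / 2 <= (1 + z) `^ q.
Proof.
move=> q0 /andP[z0 z1]; rewrite /powR gt_eqF; last by lra.
apply: le_trans (expR_ge1Dx _); rewrite lerD2l -mulrA ler_wpM2l//.
have z2 : 0 < 1 + z by lra.
have h : -1 < - (z / (1 + z)).
  by rewrite ltrN2 ltr_pdivrMr// mul1r; lra.
have := le_ln1Dx h; have -> : 1 - z / (1 + z) = (1 + z)^-1 by field; rewrite gt_eqF.
rewrite lnV ?posrE// lerN2; apply: le_trans.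
by rewrite ler_pdivlMr//; nra.
Qed.

(** With t = x_u^p, deleting u turns the form into lam (1 - 2t) and the p-mass into 1 - t. As t is
    below the average by a factor 1 - eta, the ratio to n^q gains a factor of about 1 + q eta / (2
    (n + 1)); half of this gain covers the second-order losses. *)
Lemma remove_vertex (R : realType) (p g eta : R) n (G : sgraph n.+1) v :
  1 < p -> 0 <= g -> 0 <= eta <= 1 ->
  g * n.+1%:R `^ (2 - 2 / p) <= pspectral_radius p G ->
  #|[set w | G v w]|%:R < (g * (1 - eta) - eta) * n.+1%:R ->
  32 <= (2 - 2 / p) * eta * n.+1%:R ->
  exists u, g * (1 + (2 - 2 / p) * eta / (4 * n.+1%:R)) * n%:R `^ (2 - 2 / p) <=
    pspectral_radius p (del G u).
Proof.
move=> p1 g0 /andP[eta0 eta1] lam_ge deg big; have p0 : 0 < p by lra.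
set q := 2 - 2 / p in lam_ge big *.
have q2 : q <= 2 by rewrite /q; have := divr_ge0 (ler0n R 2) (ltW p0); lra.
have q0 : 0 <= q by rewrite subr_ge0 ler_pdivrMr//; lra.
have [x [x0 xS xE]] := spectral_pair G p1 (ltn0Sn n).
have [u ut] := min_entry_small p1 g0 (introT andP (conj eta0 eta1)) x0 xS xE lam_ge deg.
exists u; set M : R := n.+1%:R in lam_ge deg big ut *.
have MS : M = n%:R + 1 by rewrite /M natr1.
have qe2 : q * eta <= 2 by nra.
have M16 : 16 <= M by have := ler_wpM2r (ler0n R n.+1) qe2; rewrite -/M; lra.
have M0 : 0 < M by lra.
set t := x u `^ p in ut; have t0 : 0 <= t by exact: powR_ge0.
have tM : t * M < 1 - eta by rewrite -ltr_pdivlMr.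
have t1 : t <= 16^-1.
  by have := ler_wpM2l t0 M16; lra.
have n0 : (0 < n)%N by rewrite -(ltr0n R); lra.
have lamE := eigenequation u p1 x0 xS xE.
have qd : qform (del G u) (fun i => x (lift u i)) = pspectral_radius p G * (1 - 2 * t).
  have := qform_set G x u 0; rewrite lamE -xE.
  have -> : qform G (fun i => if i == u then 0 else x i) =
     qform (del G u) (fun i => x (lift u i)).
    rewrite /qform (bigD1_ord u)//= eqxx mul0r add0r; apply: eq_bigr => i _.
    rewrite eq_sym (negPf (neq_lift _ _)) /wdeg; congr (_ * _).
    rewrite big_mkcond (bigD1_ord u)//= eqxx if_same add0r [RHS]big_mkcond/=.
    by apply: eq_bigr => j _; rewrite [_ == u]eq_sym (negPf (neq_lift _ _)).
  have : x u * x u `^ (p - 1) = t by rewrite mulr_powRB1.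
  by move=> <- ->; ring.
have Sd : \sum_i x (lift u i) `^ p = 1 - t.
  by move: xS; rewrite (bigD1_ord u)//= -/t; lra.
have := spectral_ub (del G u) p1 n0 (fun i => x0 (lift u i)).
rewrite qd Sd; set lam := pspectral_radius p G in lam_ge *.
set lam' := pspectral_radius p (del G u) => ub.
have lam0 : 0 <= lam by exact: spectral_ge0.
have T0 : 0 < 1 - t by lra.
have ub2 : lam * (1 - 2 * t) * (1 - t) `^ q <= lam' * (1 - t) ^+ 2.
  apply: le_trans (ler_wpM2r (powR_ge0 _ q) ub) _.
  rewrite -mulrA -powRD ?(gt_eqF T0) ?implybT//.
  by rewrite (_ : 2 / p + q = 2); [rewrite powR_mulrn// ltW|rewrite /q addrC subrK].
have [j [i0 iM jE i1]] : exists j, [/\ 0 < j, M * j = 1, M^-1 = j & j <= 16^-1].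
  exists M^-1; rewrite invr_gt0 mulfV ?gt_eqF//; split=> //.
  by rewrite lef_pV2// posrE; lra.
(* As 1 - 2t = (1 - t)^2 - t^2, the relative loss is t^2/(1 - t)^2, at most 4 j^2. *)
have ub3 : lam * (1 - 4 * j ^+ 2) * (1 - t) `^ q <= lam'.
  rewrite -(ler_pM2r (exprn_gt0 2 T0)); apply: le_trans ub2.
  rewrite [leLHS]mulrAC ler_wpM2r ?powR_ge0// -mulrA ler_wpM2l//.
  have tM' : t <= j by rewrite -jE -[leRHS]div1r ler_pdivlMr//; lra.
  have tw : t ^+ 2 <= j ^+ 2 by rewrite ler_sqr ?nnegrE// ltW.
  have w0 : 0 <= j ^+ 2 by exact: sqr_ge0.
  have T4 : 4^-1 <= (1 - t) ^+ 2 by nra.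
  have := ler_wpM2l w0 T4; move: tw; move: (j ^+ 2) => w.
  rewrite (_ : (1 - 4 * w) * _ = 1 - 2 * t + t ^+ 2 - 4 * (w * (1 - t) ^+ 2)).
    by move: (w * _) (t ^+ 2) => a b; lra.
  by ring.
have nM : n%:R = M * (1 - j) by rewrite mulrBr iM mulr1 MS addrK.
have z1 : 0 <= eta * j <= 1.
  by rewrite mulr_ge0 ?(ltW i0)//= mulr_ile1 ?(ltW i0)//; lra.
(* From t <= (1 - eta) j follows (1 - j) (1 + eta j) <= 1 - t. *)
have pw : (1 - j) `^ q * (1 + q * (eta * j) / 2) <= (1 - t) `^ q.
  apply: (le_trans (y := (1 - j) `^ q * (1 + eta * j) `^ q)).
    by rewrite ler_wpM2l ?powR_ge0// powR1D_ge.
  have [z0 _] := andP z1.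
  rewrite -powRM; [|lra|lra].
  apply: ge0_ler_powR => //; rewrite ?nnegrE; [|lra|].
    by rewrite mulr_ge0; lra.
  have : t <= (1 - eta) * j by rewrite -jE; exact: ltW.
  have : 0 <= j * (eta * j) by rewrite mulr_ge0 ?(ltW i0).
  lra.
apply: le_trans ub3; rewrite nM powRM; [|lra|lra].
have -> : g * (1 + q * eta / (4 * M)) * (M `^ q * (1 - j) `^ q) =
  (g * M `^ q) * (1 + q * eta / (4 * M)) * (1 - j) `^ q by ring.
have c1 : 0 <= 1 - 4 * j ^+ 2 by nra.
apply: (le_trans (y := lam * (1 - 4 * j ^+ 2) *
    ((1 - j) `^ q * (1 + q * (eta * j) / 2)))); last first.
  by rewrite ler_wpM2l// mulr_ge0.
rewrite [X in _ <= _ * X]mulrC mulrA ler_wpM2r ?powR_ge0// -[leRHS]mulrA.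
have qe : 0 <= q * eta by exact: mulr_ge0.
apply: ler_pM => //; rewrite ?mulr_ge0 ?powR_ge0//.
  by rewrite addr_ge0// divr_ge0// mulr_ge0 ?(ltW M0).
have -> : q * eta / (4 * M) = q * eta * j / 4 by rewrite -jE; field; rewrite gt_eqF.
set w := q * eta * j.
have -> : q * (eta * j) / 2 = w / 2 by rewrite /w mulrA.
(* Given 32 j^2 <= w <= 2, the product (1 - 4 j^2) (1 + w/2) is at least 1 + w/4. *)
have wM : 32 * j ^+ 2 <= w.
  rewrite /w expr2 mulrA ler_pM2r//.
  by have := ler_wpM2r (ltW i0) big; rewrite -[_ * M * j]mulrA iM mulr1.
have w2 : w <= 2.
  rewrite /w; apply: (le_trans (y := 2 * 1 * 1)); last by lra.
  by rewrite ler_pM ?ler_pM ?mulr_ge0 ?(ltW i0)//; lra.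
have M2 : 0 <= j ^+ 2 by exact: sqr_ge0.
nra.
Qed.

(* As long as the graph contains K_{r+1}, few (r+1)-cliques per edge force a
   vertex of low degree; deleting a vertex then raises [lambda / m^q] by at
   least [rho / n], above the value 1 - 1/r beyond which K_{r+1} is forced. *)
Lemma vertex_deletion_chain (R : realType) (p : R) n (G : sgraph n) r :
  let e : R := r%:R^-1 in let q := 2 - 2 / p in let eta := e ^+ 5 / 4 in
  let a k := 1 - e - r%:R / n%:R ^+ 2 + k%:R * (q * eta / 16) / n%:R in
  1 < p -> (2 <= r)%N -> (0 < n)%N -> 64 * r%:R <= q * eta * n%:R ->
  (exists K, is_clique G r.+1 K) ->
  (forall m, (n <= 2 * m)%N -> (js G r.+1)%:R < (e ^+ 6 * m%:R) ^+ r.-1) ->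
  a 0%N * n%:R `^ q <= pspectral_radius p G ->
  forall k m, (k + m)%N = n -> (n <= 2 * m)%N ->
  exists H : sgraph m, [/\ (js H r.+1 <= js G r.+1)%N,
    a k * m%:R `^ q <= pspectral_radius p H & exists K, is_clique H r.+1 K].
Proof.
move=> e q eta a p1 r2 n0 large cG js_small lamG.
have p0 : 0 < p by lra.
have N0 : 0 < n%:R :> R by rewrite ltr0n.
have R0 : 0 < r%:R :> R by rewrite ltr0n ltnW.
have R2 : 2 <= r%:R :> R by rewrite ler_nat.
have re : r%:R * e = 1 by rewrite mulfV// gt_eqF.
have e0 : 0 < e by rewrite invr_gt0.
have e2 : e <= 2^-1 by rewrite lef_pV2 ?posrE.
have q0 : 0 < q by rewrite subr_gt0 ltr_pdivrMr//; lra.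
have q2 : q <= 2 by rewrite /q; have := divr_ge0 (ler0n R 2) (ltW p0); lra.
have eta0 : 0 < eta by rewrite divr_gt0 ?exprn_gt0.
have etaE : e ^+ 5 = 4 * eta by rewrite /eta mulrC divfK.
have eta1 : eta <= 8^-1.
  have : e ^+ 5 <= e by rewrite -[leRHS]expr1 ler_wiXn2l ?(ltW e0)//; lra.
  by rewrite etaE; lra.
have etaN : 32 * r%:R <= eta * n%:R.
  have : q * (eta * n%:R) <= 2 * (eta * n%:R) by rewrite ler_wpM2r// mulr_ge0 ?ltW.
  by rewrite mulrA; lra.
have rn : r%:R / n%:R ^+ 2 <= eta.
  rewrite ler_pdivrMr ?exprn_gt0// expr2 mulrA; apply: (le_trans (y := eta * n%:R)).
    lra.
  by rewrite ler_peMr ?ler1n// mulr_ge0 ?ltW.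
set rho := q * eta / 16 in a lamG *.
have rho0 : 0 < rho by rewrite divr_gt0 ?mulr_gt0.
have a_ge k : 1 - e - eta <= a k.
  have : 0 <= k%:R * rho / n%:R.
    by apply: divr_ge0 => //; apply: mulr_ge0 => //; exact: ltW.
  by rewrite /a; lra.
elim=> [m|k IH m] kmn nm.
  by move: kmn; rewrite add0n => mn; subst m; exists G.
have nm1 : (n <= 2 * m.+1)%N by rewrite (leq_trans nm)// leq_mul2l leqnSn.
have mn : (m.+1 <= n)%N by rewrite -kmn addSn ltnS leq_addl.
have m0 : (0 < m)%N by move: nm n0; case: (m) => //; rewrite muln0 leqn0 => /eqP->.
have km1 : (k + m.+1)%N = n by rewrite addnS -addSn.
have [H [jsH lamH [K cK]]] := IH m.+1 km1 nm1.
set M : R := m.+1%:R in lamH.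
have M0 : 0 < M by rewrite ltr0n.
have [v dv] : exists v, #|[set w | H v w]|%:R < (1 - e - e ^+ 5) * M.
  apply: contrapT => nov.
  have /(js_ge_min_degree r2 cK) : forall v, (1 - e - e ^+ 5) * M <= #|[set w | H v w]|%:R.
    by move=> v; rewrite leNgt; apply/negP => lt; apply: nov; exists v.
  apply/negP; rewrite -ltNge; apply: le_lt_trans (js_small m.+1 nm1).
  by rewrite ler_nat.
have ak := a_ge k; have ak4 : 4^-1 <= a k by lra.
(* This dictates eta = e^5 / 4: one eta is lost in a k >= 1 - e - eta, one in the factor 1 - eta and
   one at the end, and all fit within e^5. *)
have dv' : #|[set w | H v w]|%:R < (a k * (1 - eta) - eta) * M.
  apply: lt_le_trans dv _; rewrite ler_pM2r// etaE.
  have : (1 - e - eta) * (1 - eta) <= a k * (1 - eta) by rewrite ler_wpM2r//; lra.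
  have : 0 <= eta * e by rewrite mulr_ge0 ?ltW.
  have : 0 <= eta * eta by rewrite mulr_ge0 ?ltW.
  lra.
have qM : 32 <= q * eta * M.
  have : n%:R <= 2 * M by rewrite -natrM ler_nat.
  move=> /(ler_wpM2l (mulr_ge0 (ltW q0) (ltW eta0))).
  lra.
have ak0 : 0 <= a k by lra.
have eta01 : 0 <= eta <= 1 by rewrite (ltW eta0)/=; lra.
have [u lamD] := remove_vertex p1 ak0 eta01 lamH dv' qM.
(* As a k >= 1/4 and m + 1 <= n, the multiplicative gain is at least the additive rho / n. *)
have step : a k.+1 <= a k * (1 + q * eta / (4 * M)).
  have -> : a k.+1 = a k + rho / n%:R by rewrite /a -natr1; ring.
  rewrite mulrDr mulr1 lerD2l.
  apply: (le_trans (y := 4^-1 * (q * eta / (4 * M)))); last first.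
    by rewrite ler_wpM2r// divr_ge0 ?mulr_ge0 ?ltW.
  have -> : 4^-1 * (q * eta / (4 * M)) = rho / M by rewrite /rho; field; rewrite gt_eqF.
  by rewrite ler_wpM2l ?(ltW rho0)// lef_pV2 ?posrE// ler_nat.
have lamD' : a k.+1 * m%:R `^ q <= pspectral_radius p (del H u).
  by apply: le_trans lamD; rewrite ler_wpM2r ?powR_ge0.
exists (del H u); split=> //; first by apply: leq_trans (js_del H u _) jsH.
(* A single deletion lifts the value above 1 - e, since rho n > r pays for the deficit r / n^2 of
   the Turan bound. Half the excess is taken to keep the inequality strict. *)
pose th := (a k.+1 - (1 - e)) / 2.
have th0 : 0 < th.
  rewrite divr_gt0// /a.
  have -> : 1 - e - r%:R / n%:R ^+ 2 + k.+1%:R * rho / n%:R - (1 - e) =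
     (k.+1%:R * (rho * n%:R) - r%:R) / n%:R ^+ 2 by field; rewrite gt_eqF.
  rewrite divr_gt0 ?exprn_gt0// subr_gt0.
  apply: (lt_le_trans (y := rho * n%:R)).
    by rewrite /rho mulrAC ltr_pdivlMr//; lra.
  by rewrite ler_peMl ?ler1n// mulr_ge0 ?ltW.
have [|//] := @js_of_spectral R p m (del H u) r th p1 r2 m0 th0.
apply: lt_le_trans lamD'; rewrite ltr_pM2r ?powR_gt0 ?ltr0n//.
by rewrite -/e /th; move: th0; rewrite /th; lra.
Qed.

(** * Small and large n *)

Theorem theorem5 (R : realType) (r : nat) (p : R) (n : nat) (G : sgraph n)
    (hr : (2 <= r)%N) (hp : 1 < p)
    (hG : pspectral_radius p (turan r n) <= pspectral_radius p G)
    (hneq : ~ graph_iso G (turan r n)) :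
  (js G r.+1)%:R > n%:R ^+ r.-1 / r%:R `^ (r%:R ^+ 6 * p / (p - 1)) :> R.
Proof.
have p0 : 0 < p by lra.
have n0 : (0 < n)%N.
  by case: n G hG hneq => // G _ []; exists 1%g => -[].
have N0 : 0 < n%:R :> R by rewrite ltr0n.
have [r_gt0 exp14 exp7 exp4] : [/\ 0 < r.-1, 14 * r.-1 <= r ^ 6, 7 * r.-1 < r ^ 6 &
    4 * r + 13 < r ^ 6]%N.
  have : (32 * r <= r ^ 6)%N.
    by rewrite expnSr leq_mul2r; apply/orP; right; rewrite (@leq_exp2r 2 r 5).
  by move: (r ^ 6)%N hr => X; clear=> *; split; lia.
(* The powers of f spent at the end: 9 + 5 for rho / 8, then 2 r - 1 and r + 1 from
   [js_of_spectral], and r - 1 for replacing m by f n. *)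
have expE : (9 + 5 + (2 * r).-1 + r.+1 + r.-1 = 4 * r + 13)%N by clear -hr; lia.
pose k := n./2; pose m := (n - n./2)%N.
have [km nm n4k] : [/\ (k + m)%N = n, (n <= 2 * m)%N & (32 <= n)%N -> (n <= 4 * k)%N].
  by rewrite /k /m; clear; split; lia.
have m0 : (0 < m)%N by clear -nm n0; lia.
have cG : exists K, is_clique G r.+1 K.
  apply: contrapT => noK; apply: hneq; apply: (spectral_turan hp hr _ hG) => K.
  by apply/negP => cK; apply: noK; exists K.
have R0 : 0 < r%:R :> R by rewrite ltr0n ltnW.
have R2 : 2 <= r%:R :> R by rewrite ler_nat.
set e : R := r%:R^-1.
have re : r%:R * e = 1 by rewrite mulfV// gt_eqF.
have e0 : 0 < e by rewrite invr_gt0.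
have e2 : e <= 2^-1 by rewrite lef_pV2 ?posrE.
set q := 2 - 2 / p; set u := p / (p - 1).
have pm : 0 < p - 1 by lra.
have u1 : 1 < u by rewrite ltr_pdivlMr//; lra.
have qu : q * u = 2 by rewrite /q /u; field; rewrite !gt_eqF.
set f := (r%:R `^ u)^-1.
have X0 : 0 < r%:R `^ u by exact: powR_gt0.
have f0 : 0 < f by rewrite invr_gt0.
have fe : f <= e.
  by rewrite lef_pV2 ?posrE// -[leLHS]powRr1 ?ler_powR ?ler1n ?(ltW u1) ?(ltnW hr)// ltW.
(* Uses u <= 2^u <= r^u, the first by the tangent of the power at 1. *)
have fu : f * u <= 1.
  rewrite mulrC ler_pdivrMr// mul1r; apply: (le_trans (y := 2 `^ u)).
    have := powR_tangent u1 (ler0n R 2) ler01; rewrite !powR1; lra.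
  by apply: ge0_ler_powR; rewrite ?nnegrE//; lra.
have f2 : f <= 2^-1 by exact: le_trans e2.
have f1 : f < 1 by lra.
have fX a b : (a <= b)%N -> f ^+ b <= f ^+ a by move=> ab; rewrite ler_wiXn2l ?ltW.
(* All constants are compared as powers of [f = r^(-p/(p-1))], using
   [f <= 1/r] and [f * p/(p-1) <= 1]. *)
have -> : n%:R ^+ r.-1 / r%:R `^ (r%:R ^+ 6 * p / (p - 1)) = n%:R ^+ r.-1 * f ^+ (r ^ 6).
  rewrite (_ : _ * p / (p - 1) = u * (r ^ 6)%:R); last first.
    by rewrite natrX /u -mulrA mulrC.
  by rewrite powRrM powR_mulrn ?(ltW X0)// exprVn.
have Nr : 0 < n%:R ^+ r.-1 :> R by rewrite exprn_gt0.
(* Because q u = 2, this threshold is where q eta n reaches the 64 r required by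
   [vertex_deletion_chain]. Below it the claimed bound is under 1, while [G] contains a K_{r+1}. *)
have [large|small] := lerP (128 * u * r%:R ^+ 6) n%:R; last first.
  have js1 : 1 <= (js G r.+1)%:R :> R.
    by have [K cK] := cG; rewrite ler1n (js_gt0 cK)// ltnS ltnW.
  apply: lt_le_trans js1.
  apply: (le_lt_trans (y := (n%:R * f ^+ 14) ^+ r.-1)).
    by rewrite exprMn ler_pM2l// -exprM; apply: fX.
  have lt1 : n%:R * f ^+ 14 < 1.
    apply: (lt_le_trans (y := 128 * u * r%:R ^+ 6 * f ^+ 14)).
      by rewrite ltr_pM2r ?exprn_gt0.
    (* Of the fourteen factors f, seven absorb 128 = 2^7, one absorbs u and six absorb r^6. *)
    have -> : 128 * u * r%:R ^+ 6 * f ^+ 14 = (2 * f) ^+ 7 * ((f * u) * (r%:R * f) ^+ 6).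
      by ring.
    have rf : r%:R * f <= 1 by rewrite -[leRHS]re ler_pM2l.
    have [f0' u0] : 0 <= f /\ 0 <= u by split; lra.
    have c0 : 0 <= f * u by exact: mulr_ge0.
    have b0 : 0 <= r%:R * f by exact: mulr_ge0.
    have a0 : 0 <= 2 * f by exact: mulr_ge0.
    apply: mulr_ile1.
    - exact: exprn_ge0.
    - by rewrite mulr_ge0 ?exprn_ge0.
    - by apply: exprn_ile1 => //; lra.
    - by apply: mulr_ile1; rewrite ?exprn_ge0 ?exprn_ile1.
  rewrite exprn_ilt1//; first by rewrite -lt0n.
  by apply: mulr_ge0 => //; apply: exprn_ge0; exact: ltW.
rewrite ltNge; apply/negP => js_le.
have half l : (n <= 2 * l)%N -> f * n%:R <= l%:R.
  move=> nl; have : n%:R <= 2 * l%:R :> R by rewrite -natrM ler_nat.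
  have : f * n%:R <= 2^-1 * n%:R by rewrite ler_wpM2r.
  lra.
have js_small l : (n <= 2 * l)%N -> (js G r.+1)%:R < (e ^+ 6 * l%:R) ^+ r.-1.
  move=> /half fm; apply: le_lt_trans js_le _.
  (* Since r^6 > 7 (r - 1), seven factors f are available in each power: six to stay below e^6, one
     to pass from n to l. *)
  apply: (lt_le_trans (y := (f ^+ 6 * (f * n%:R)) ^+ r.-1)).
    rewrite mulrA -exprSr exprMn mulrC ltr_pM2r// -exprM.
    by rewrite ltr_iXn2l.
  apply: lerXn2r; rewrite ?nnegrE ?mulr_ge0 ?exprn_ge0 ?(ltW f0) ?(ltW e0)//.
  by rewrite ler_pM ?mulr_ge0 ?exprn_ge0 ?(ltW f0)// lerXn2r ?nnegrE ?(ltW f0) ?(ltW e0).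
pose eta := e ^+ 5 / 4.
have e5 : e ^+ 5 * r%:R ^+ 6 = r%:R.
  by rewrite [r%:R ^+ 6]exprSr mulrA -exprMn [e * _]mulrC re expr1n mul1r.
have large' : 64 * r%:R <= q * eta * n%:R.
  have q0 : 0 <= q by rewrite /q subr_ge0 ler_pdivrMr//; lra.
  have qe : 0 <= q * eta by rewrite mulr_ge0 ?divr_ge0 ?exprn_ge0 ?(ltW e0).
  apply: le_trans (ler_wpM2l qe large).
  rewrite [leRHS](_ : _ = 32 * (q * u) * (e ^+ 5 * r%:R ^+ 6)); last by rewrite /eta; field.
  by rewrite qu e5; lra.
have lam0 : (1 - e - r%:R / n%:R ^+ 2 + 0 * (q * eta / 16) / n%:R) * n%:R `^ q <=
    pspectral_radius p G.
  rewrite !mul0r addr0; apply: le_trans hG; exact: turan_spectral_ge (ltnW hr) n0.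
have [H [jsH lamH _]] := vertex_deletion_chain hp hr n0 large' cG js_small lam0 km nm.
set rho := q * eta / 16 in lamH.
have q0 : 0 < q by rewrite /q subr_gt0 ltr_pdivrMr//; lra.
have eta0 : 0 < eta by rewrite divr_gt0 ?exprn_gt0.
have rho0 : 0 < rho by rewrite divr_gt0 ?mulr_gt0.
have rhoN : 4 * r%:R <= rho * n%:R by rewrite /rho mulrAC ler_pdivlMr//; lra.
have n32 : 32 <= n%:R :> R.
  apply: le_trans large; have r1 : 1 <= r%:R ^+ 6 :> R by rewrite exprn_ege1; lra.
  have : 1 * 1 <= u * r%:R ^+ 6 by rewrite ler_pM//; lra.
  lra.
have th0 : 0 < rho / 8 by rewrite divr_gt0.
(* At least n/4 deletions gain rho/4 or more, of which the deficit r / n^2 takes at most rho/128. *)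
have gap : 1 - e + rho / 8 < 1 - e - r%:R / n%:R ^+ 2 + k%:R * rho / n%:R.
  have k4 : n%:R <= 4 * k%:R :> R.
    by rewrite -natrM ler_nat n4k// -(ler_nat R).
  have le1 : rho / 4 <= k%:R * rho / n%:R.
    by rewrite ler_pdivlMr//; have := ler_wpM2l (ltW rho0) k4; lra.
  have le2 : r%:R / n%:R ^+ 2 <= rho / 128.
    rewrite ler_pdivrMr ?exprn_gt0// mulrAC ler_pdivlMr//.
    have := ler_pM (mulr_ge0 (ler0n R 4) (ltW R0)) (ler0n R 32) rhoN n32.
    by rewrite expr2 mulrA; lra.
  lra.
have [|_] := @js_of_spectral R p m H r (rho / 8) hp hr m0 th0.
  by apply: lt_le_trans lamH; rewrite ltr_pM2r ?powR_gt0 ?ltr0n.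
rewrite -/e -/u -/f; apply/negP; rewrite -ltNge.
apply: (le_lt_trans (y := (js G r.+1)%:R)); first by rewrite ler_nat.
apply: le_lt_trans js_le _.
apply: (lt_le_trans (y := n%:R ^+ r.-1 * f ^+ (4 * r + 13))).
  by rewrite ltr_pM2l// ltr_iXn2l.
have -> : n%:R ^+ r.-1 * f ^+ (4 * r + 13) =
   f ^+ 9 * f ^+ 5 * f ^+ (2 * r).-1 * f ^+ r.+1 * (f * n%:R) ^+ r.-1.
  rewrite exprMn mulrA [RHS]mulrC; congr (_ * _); by rewrite -!exprD -expE addnC.
have f0' := ltW f0; have e0' := ltW e0.
have n512 : 0 < 512 :> R by exact: ltr0n.
(* As q = 2/u, this amounts to 256 f^9 u <= 1: eight factors f absorb 2^8 and one absorbs u. *)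
have f9 : f ^+ 9 * 512 <= q.
  have f8 : (2 * f) ^+ 8 <= 1.
    by apply: exprn_ile1; [exact: mulr_ge0|lra].
  have := mulr_ile1 (exprn_ge0 8 (mulr_ge0 (ler0n R 2) f0'))
    (mulr_ge0 f0' (ltW (lt_trans ltr01 u1))) f8 fu.
  rewrite -(ler_pM2r (lt_trans ltr01 u1) _ q) qu.
  have -> : (2 * f) ^+ 8 * (f * u) = 256 * (f ^+ 9 * u) by ring.
  by rewrite [_ * 512 * u]mulrAC; lra.
have rho_ge : f ^+ 9 * f ^+ 5 <= rho / 8.
  have -> : rho / 8 = q / 512 * e ^+ 5 by rewrite /rho /eta; field.
  apply: ler_pM; rewrite ?exprn_ge0 ?lerXn2r ?nnegrE//.
  by rewrite (ler_pdivlMr _ _ n512).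
apply: ler_pM; rewrite ?mulr_ge0 ?exprn_ge0 ?mulr_ge0//; last first.
  by rewrite lerXn2r ?nnegrE ?mulr_ge0// half.
apply: ler_pM; rewrite ?mulr_ge0 ?exprn_ge0//.
by apply: ler_pM; rewrite ?mulr_ge0 ?exprn_ge0// lerXn2r ?nnegrE.
Qed.
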